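(* Let $n\ge 1$ and let $J$ be the ideal of $\mathfrak{e}_{D_{2n+1}}$ generated by $e_1-e_{\bar1}$. Then $J$ is the radical (the largest solvable ideal) of $\mathfrak{e}_{D_{2n+1}}$, and $\mathfrak{e}_{D_{2n+1}}/J\cong\mathfrak{sp}_{2n}$.
   Context: All Lie algebras are over $\mathbb{C}$. The Dynkin diagram $D_{m+1}$ ($m\ge 2$) has nodes $\bar 1,1,2,\dots,m$ with edges $\bar1-2$, $1-2$, and $i-(i+1)$ for $2\le i\le m-1$. $\mathfrak{e}_{D_{m+1}}$ is generated by $e_{\bar1},e_1,e_2,\dots,e_m$ subject to: $[e_a,[e_a,e_b]]=-2e_a$ whenever $a,b$ are adjacent nodes (in either order), and $[e_a,e_b]=0$ whenever $a\ne b$ are non-adjacent nodes. $\mathfrak{sp}_{2n}$ is the symplectic Lie algebra of $2n\times2n$ matrices. *)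

(* Defs.v *)
From HB Require Import structures.
From mathcomp Require Import all_boot all_order all_algebra.
From mathcomp Require Import generic_quotient ring_quotient.
From mathcomp Require Import boolp classical_sets reals.
From mathcomp Require Import complex ring.

Set Implicit Arguments.
Unset Strict Implicit.
Unset Printing Implicit Defensive.

Import GRing.Theory.

Local Open Scope classical_set_scope.
Local Open Scope quotient_scope.
Local Open Scope ring_scope.

HB.mixin Record Lmodule_isLie (F : fieldType) L of GRing.Lmodule F L := {
  lie : L -> L -> L;
  lie_linearl : forall z, linear (fun x => lie x z);
  lie_linearr : forall z, linear (lie z);
  liexx : forall x, lie x x = 0;
  lie_jacobi : forall x y z,
    lie x (lie y z) + lie y (lie z x) + lie z (lie x y) = 0 }.

#[short(type="lieType")]
HB.structure Definition Lie (F : fieldType) :=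
  { L of GRing.Lmodule F L & Lmodule_isLie F L }.

Lemma liePl (F : fieldType) (L : lieType F) (a : F) (x y z : L) :
  lie (a *: x + y) z = a *: lie x z + lie y z.
Proof. exact: lie_linearl. Qed.

Lemma liePr (F : fieldType) (L : lieType F) (a : F) (x y z : L) :
  lie z (a *: x + y) = a *: lie z x + lie z y.
Proof. exact: lie_linearr. Qed.

Lemma lieC (F : fieldType) (L : lieType F) (x y : L) : lie x y = - lie y x.
Proof.
apply/eqP; rewrite -addr_eq0; apply/eqP.
have := liexx (1 *: x + y).
by rewrite liePl !liePr !liexx !scale1r add0r addr0.
Qed.

Definition lie_iso (F : fieldType) (L1 L2 : lieType F) :=
  exists f : {linear L1 -> L2},
    bijective f /\ forall x y, f (lie x y) = lie (f x) (f y).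

Section Ideals.
Variables (F : fieldType) (L : lieType F).
Implicit Types (S I J : set L).

Definition is_subspace S := S 0 /\ forall (a : F) x y, S x -> S y -> S (a *: x + y).

(* The bracket is antisymmetric, so closure on one side gives both sides. *)
Definition is_ideal I := is_subspace I /\ forall x y, I y -> I (lie x y).

Record lieIdeal := LieIdeal { ideal_set :> set L; idealP : is_ideal ideal_set }.

Definition lie_span S := smallest is_subspace S.

Definition lie_prod I J := lie_span [set lie x y | x in I & y in J].

Definition derived I k := iter k (fun D => lie_prod D D) I.

Definition solvable I := exists k, derived I k = [set 0].

Definition is_radical I :=
  [/\ is_ideal I, solvable I &
      forall K, is_ideal K -> solvable K -> K `<=` I].

Lemma ideal_gen_subproof S : is_ideal (smallest is_ideal S).
Proof.
split; [split|].
- by move=> I [[[]]].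
- move=> a x y Sx Sy I [II SI].
  by case: (II) => -[_ +] _; apply; [apply: Sx|apply: Sy].
- by move=> x y Sy I [II SI]; case: (II) => _; apply; apply: Sy.
Qed.

Definition ideal_gen S : lieIdeal := LieIdeal (ideal_gen_subproof S).

Definition ideal_mem (I : lieIdeal) : {pred L} := fun x => `[< ideal_set I x >].

Lemma ideal_memP (I : lieIdeal) : submod_closed (ideal_mem I).
Proof.
have [[I0 IP] _] := idealP I; split; first exact/asboolP.
by move=> a x y /asboolP Ix /asboolP Iy; apply/asboolP; exact: IP.
Qed.

HB.instance Definition _ (I : lieIdeal) :=
  GRing.isSubmodClosed.Build F L (ideal_mem I)
    (GRing.submod_closed_semi (ideal_memP I)).

End Ideals.

(* The additive group of L / I is MathComp's quotient by a zmodClosed predicate;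
   scaling and bracket are computed on representatives. *)
Section LieQuotient.
Variables (F : fieldType) (L : lieType F) (I : lieIdeal L).

Definition lie_quot := ring_quotient.Quotient.quot (ideal_mem I : zmodClosed L).

HB.instance Definition _ := GRing.Zmodule.on lie_quot.

Definition lie_pi (x : L) : lie_quot := \pi_lie_quot x.

Lemma lie_pi_eq x y : lie_pi x = lie_pi y <-> ideal_set I (x - y).
Proof.
split=> [|Ixy].
  by move=> /eqP; rewrite /lie_pi -ring_quotient.Quotient.idealrBE => /asboolP.
by apply/eqP; rewrite /lie_pi -ring_quotient.Quotient.idealrBE; apply/asboolP.
Qed.

Lemma lie_piK (x : lie_quot) : lie_pi (repr x) = x.
Proof. exact: reprK. Qed.

Lemma lie_piD x y : lie_pi (x + y) = lie_pi x + lie_pi y.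
Proof. exact: ring_quotient.Quotient.pi_add. Qed.

Let ideal0 : ideal_set I 0.
Proof. by have [[]] := idealP I. Qed.

Let idealL (a : F) x y :
  ideal_set I x -> ideal_set I y -> ideal_set I (a *: x + y).
Proof. by have [[_ +] _] := idealP I; apply. Qed.

Let idealZ (a : F) x : ideal_set I x -> ideal_set I (a *: x).
Proof. by move=> Ix; rewrite -[a *: x]addr0; exact: idealL. Qed.

Let ideal_lier x y : ideal_set I y -> ideal_set I (lie x y).
Proof. by have [_ +] := idealP I; apply. Qed.

Let lieBr (x y z : L) : lie x (y - z) = lie x y - lie x z.
Proof. by rewrite [y - z]addrC -[- z]scaleN1r liePr scaleN1r addrC. Qed.

Let lieBl (x y z : L) : lie (x - y) z = lie x z - lie y z.
Proof. by rewrite [x - y]addrC -[- y]scaleN1r liePl scaleN1r addrC. Qed.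

Let ideal_liel x y : ideal_set I x -> ideal_set I (lie x y).
Proof.
by move=> Ix; rewrite lieC -scaleN1r; apply/idealZ/ideal_lier.
Qed.

Definition lq_scale (a : F) (x : lie_quot) : lie_quot := lie_pi (a *: repr x).

Definition lq_lie (x y : lie_quot) : lie_quot := lie_pi (lie (repr x) (repr y)).

Lemma lie_piZ a x : lq_scale a (lie_pi x) = lie_pi (a *: x).
Proof.
apply/lie_pi_eq; rewrite -scalerBr; apply/idealZ/lie_pi_eq.
exact: lie_piK.
Qed.

Lemma lie_pi_lie x y : lq_lie (lie_pi x) (lie_pi y) = lie_pi (lie x y).
Proof.
apply/lie_pi_eq; set x' := repr _; set y' := repr _.
have Ix : ideal_set I (x' - x) by apply/lie_pi_eq; exact: lie_piK.
have Iy : ideal_set I (y' - y) by apply/lie_pi_eq; exact: lie_piK.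
have -> : lie x' y' - lie x y = 1 *: lie (x' - x) y' + lie x (y' - y).
  by rewrite scale1r lieBl lieBr addrA subrK.
by apply: idealL; [exact: ideal_liel|exact: ideal_lier].
Qed.

Fact lq_scaleA a b x : lq_scale a (lq_scale b x) = lq_scale (a * b) x.
Proof. by rewrite -(lie_piK x) !lie_piZ scalerA. Qed.

Fact lq_scale1 : left_id 1 lq_scale.
Proof. by move=> x; rewrite -{1}(lie_piK x) lie_piZ scale1r lie_piK. Qed.

Fact lq_scaleDr : right_distributive lq_scale +%R.
Proof.
move=> a x y; rewrite -(lie_piK x) -(lie_piK y).
by rewrite -lie_piD !lie_piZ scalerDr lie_piD.
Qed.

Fact lq_scaleDl x : {morph lq_scale^~ x : a b / a + b}.
Proof. by move=> a b; rewrite -(lie_piK x) !lie_piZ scalerDl lie_piD. Qed.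

HB.instance Definition _ := GRing.Zmodule_isLmodule.Build F lie_quot
  lq_scaleA lq_scale1 lq_scaleDr lq_scaleDl.

Fact lq_linearl z : linear (fun x => lq_lie x z).
Proof.
move=> a x y; rewrite -(lie_piK x) -(lie_piK y) -(lie_piK z).
rewrite [a *: _]lie_piZ -lie_piD !lie_pi_lie [RHS]/GRing.add /=.
by rewrite liePl lie_piD -lie_piZ.
Qed.

Fact lq_linearr z : linear (lq_lie z).
Proof.
move=> a x y; rewrite -(lie_piK x) -(lie_piK y) -(lie_piK z).
rewrite [a *: _]lie_piZ -lie_piD !lie_pi_lie.
by rewrite liePr lie_piD -lie_piZ.
Qed.

Fact lq_liexx x : lq_lie x x = 0.
Proof.
rewrite -(lie_piK x) lie_pi_lie liexx.
by apply: (addrI (lie_pi 0)); rewrite -lie_piD !addr0.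
Qed.

Fact lq_jacobi x y z :
  lq_lie x (lq_lie y z) + lq_lie y (lq_lie z x) + lq_lie z (lq_lie x y) = 0.
Proof.
rewrite -(lie_piK x) -(lie_piK y) -(lie_piK z).
rewrite !lie_pi_lie -!lie_piD lie_jacobi.
by apply: (addrI (lie_pi 0)); rewrite -lie_piD !addr0.
Qed.

HB.instance Definition _ := Lmodule_isLie.Build F lie_quot
  lq_linearl lq_linearr lq_liexx lq_jacobi.

End LieQuotient.

(* The free Lie algebra on X: formal expressions in the generators modulo the
   smallest congruence that forces the axioms of a Lie algebra. *)
Inductive lie_term (F X : Type) : Type :=
  | LGen of X
  | LZero
  | LOpp of lie_term F X
  | LAdd of lie_term F X & lie_term F X
  | LScale of F & lie_term F X
  | LBr of lie_term F X & lie_term F X.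

Arguments LGen {F X}.
Arguments LZero {F X}.

Inductive lie_cong (F : fieldType) (X : Type) :
    lie_term F X -> lie_term F X -> Prop :=
  | lc_refl t : lie_cong t t
  | lc_sym t u : lie_cong t u -> lie_cong u t
  | lc_trans t u v : lie_cong t u -> lie_cong u v -> lie_cong t v
  | lc_opp t t' : lie_cong t t' -> lie_cong (LOpp t) (LOpp t')
  | lc_add t t' u u' : lie_cong t t' -> lie_cong u u' ->
      lie_cong (LAdd t u) (LAdd t' u')
  | lc_scale a t t' : lie_cong t t' -> lie_cong (LScale a t) (LScale a t')
  | lc_br t t' u u' : lie_cong t t' -> lie_cong u u' ->
      lie_cong (LBr t u) (LBr t' u')
  | lc_addA t u v : lie_cong (LAdd t (LAdd u v)) (LAdd (LAdd t u) v)
  | lc_addC t u : lie_cong (LAdd t u) (LAdd u t)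
  | lc_add0 t : lie_cong (LAdd LZero t) t
  | lc_addN t : lie_cong (LAdd (LOpp t) t) LZero
  | lc_scaleA a b t : lie_cong (LScale a (LScale b t)) (LScale (a * b) t)
  | lc_scale1 t : lie_cong (LScale 1 t) t
  | lc_scaleDr a t u :
      lie_cong (LScale a (LAdd t u)) (LAdd (LScale a t) (LScale a u))
  | lc_scaleDl a b t :
      lie_cong (LScale (a + b) t) (LAdd (LScale a t) (LScale b t))
  | lc_linearl a t u v :
      lie_cong (LBr (LAdd (LScale a t) u) v) (LAdd (LScale a (LBr t v)) (LBr u v))
  | lc_linearr a t u v :
      lie_cong (LBr v (LAdd (LScale a t) u)) (LAdd (LScale a (LBr v t)) (LBr v u))
  | lc_brxx t : lie_cong (LBr t t) LZero
  | lc_jacobi t u v :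
      lie_cong (LAdd (LAdd (LBr t (LBr u v)) (LBr u (LBr v t))) (LBr v (LBr t u)))
        LZero.

HB.instance Definition _ (F X : Type) := gen_eqMixin (lie_term F X).
HB.instance Definition _ (F X : Type) := gen_choiceMixin (lie_term F X).

Section FreeLie.
Variables (F : fieldType) (X : Type).

Definition lie_congb (t u : lie_term F X) := `[< lie_cong t u >].

Lemma lie_congb_equiv : equiv_class_of lie_congb.
Proof.
split=> [t|t u|t u v]; first exact/asboolP/lc_refl.
  by apply: asbool_equiv_eq; split; exact: lc_sym.
by move=> /asboolP ut /asboolP tv; apply/asboolP; exact: lc_trans ut tv.
Qed.

Canonical lie_congb_equivRel := EquivRelPack lie_congb_equiv.
Canonical lie_congb_encModRel := defaultEncModRel lie_congb.

Definition free_lie := {eq_quot lie_congb}.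

HB.instance Definition _ := Choice.on free_lie.

Definition fl_pi (t : lie_term F X) : free_lie := \pi_free_lie t.

Lemma fl_pi_eq t u : fl_pi t = fl_pi u <-> lie_cong t u.
Proof.
split=> [|tu].
  by move=> /eqP; rewrite /fl_pi [_ == _]eqmodE => /asboolP.
by apply/eqP; rewrite /fl_pi [_ == _]eqmodE; apply/asboolP.
Qed.

Lemma fl_piK (x : free_lie) : fl_pi (repr x) = x.
Proof. exact: reprK. Qed.

Definition fl_gen (i : X) : free_lie := fl_pi (LGen i).
Definition fl_zero : free_lie := fl_pi LZero.
Definition fl_opp (x : free_lie) : free_lie := fl_pi (LOpp (repr x)).
Definition fl_add (x y : free_lie) : free_lie :=
  fl_pi (LAdd (repr x) (repr y)).
Definition fl_scale (a : F) (x : free_lie) : free_lie :=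
  fl_pi (LScale a (repr x)).
Definition fl_lie (x y : free_lie) : free_lie :=
  fl_pi (LBr (repr x) (repr y)).

Let reprP t : lie_cong (repr (fl_pi t)) t.
Proof. by apply/fl_pi_eq; rewrite fl_piK. Qed.

Lemma fl_piN t : fl_opp (fl_pi t) = fl_pi (LOpp t).
Proof. by apply/fl_pi_eq/lc_opp/reprP. Qed.

Lemma fl_piD t u : fl_add (fl_pi t) (fl_pi u) = fl_pi (LAdd t u).
Proof. by apply/fl_pi_eq/lc_add; exact: reprP. Qed.

Lemma fl_piZ a t : fl_scale a (fl_pi t) = fl_pi (LScale a t).
Proof. by apply/fl_pi_eq/lc_scale/reprP. Qed.

Lemma fl_pi_lie t u : fl_lie (fl_pi t) (fl_pi u) = fl_pi (LBr t u).
Proof. by apply/fl_pi_eq/lc_br; exact: reprP. Qed.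

Let flE := (fl_piN, fl_piD, fl_piZ, fl_pi_lie).

Fact fl_addA : associative fl_add.
Proof.
move=> x y z; rewrite -(fl_piK x) -(fl_piK y) -(fl_piK z) !flE.
exact/fl_pi_eq/lc_addA.
Qed.

Fact fl_addC : commutative fl_add.
Proof. by move=> x y; apply/fl_pi_eq/lc_addC. Qed.

Fact fl_add0 : left_id fl_zero fl_add.
Proof. by move=> x; rewrite -(fl_piK x) !flE; apply/fl_pi_eq/lc_add0. Qed.

Fact fl_addN : left_inverse fl_zero fl_opp fl_add.
Proof. by move=> x; rewrite -(fl_piK x) !flE; apply/fl_pi_eq/lc_addN. Qed.

HB.instance Definition _ :=
  GRing.isZmodule.Build free_lie fl_addA fl_addC fl_add0 fl_addN.

Fact fl_scaleA a b x : fl_scale a (fl_scale b x) = fl_scale (a * b) x.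
Proof. by rewrite -(fl_piK x) !flE; apply/fl_pi_eq/lc_scaleA. Qed.

Fact fl_scale1 : left_id 1 fl_scale.
Proof. by move=> x; rewrite -(fl_piK x) !flE; apply/fl_pi_eq/lc_scale1. Qed.

Fact fl_scaleDr : right_distributive fl_scale +%R.
Proof.
move=> a x y; rewrite -(fl_piK x) -(fl_piK y) /GRing.add /= !flE.
exact/fl_pi_eq/lc_scaleDr.
Qed.

Fact fl_scaleDl x : {morph fl_scale^~ x : a b / a + b}.
Proof.
move=> a b; rewrite -(fl_piK x) [RHS]/GRing.add /= !flE.
exact/fl_pi_eq/lc_scaleDl.
Qed.

HB.instance Definition _ := GRing.Zmodule_isLmodule.Build F free_lie
  fl_scaleA fl_scale1 fl_scaleDr fl_scaleDl.

Fact fl_linearl z : linear (fun x => fl_lie x z).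
Proof.
move=> a x y; rewrite -(fl_piK x) -(fl_piK y) -(fl_piK z).
rewrite /GRing.scale /GRing.add /= !flE; exact/fl_pi_eq/lc_linearl.
Qed.

Fact fl_linearr z : linear (fl_lie z).
Proof.
move=> a x y; rewrite -(fl_piK x) -(fl_piK y) -(fl_piK z).
rewrite /GRing.scale /GRing.add /= !flE; exact/fl_pi_eq/lc_linearr.
Qed.

Fact fl_liexx x : fl_lie x x = 0.
Proof. exact/fl_pi_eq/lc_brxx. Qed.

Fact fl_jacobi x y z :
  fl_lie x (fl_lie y z) + fl_lie y (fl_lie z x) + fl_lie z (fl_lie x y) = 0.
Proof.
rewrite -(fl_piK x) -(fl_piK y) -(fl_piK z) /GRing.add /= !flE.
exact/fl_pi_eq/lc_jacobi.
Qed.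

HB.instance Definition _ := Lmodule_isLie.Build F free_lie
  fl_linearl fl_linearr fl_liexx fl_jacobi.

End FreeLie.

(* Nodes of the Dynkin diagram D_{m+1} are 0, 1, ..., m in 'I_m.+1, where 0
   stands for the node \bar 1 and i stands for the node i when i >= 1. *)
Definition D_edge (m : nat) (i j : 'I_m.+1) : bool :=
  [|| (i == 0 :> nat) && (j == 2 :> nat),
      (i == 1 :> nat) && (j == 2 :> nat) |
      (2 <= i)%N && (j == i.+1 :> nat)].

Definition D_adj (m : nat) (i j : 'I_m.+1) : bool := D_edge i j || D_edge j i.

Definition eD_relators (F : fieldType) (m : nat) : set (free_lie F 'I_m.+1) :=
  let g := @fl_gen F 'I_m.+1 in
  [set r | exists a b : 'I_m.+1,
    D_adj a b /\ r = lie (g a) (lie (g a) (g b)) - (- 2%:R *: g a)] `|`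
  [set r | exists a b : 'I_m.+1,
    [/\ a != b, ~~ D_adj a b & r = lie (g a) (g b)]].

(* The electrical Lie algebra of type D_{m+1}. *)
Definition eD (F : fieldType) (m : nat) : lieType F :=
  lie_quot (ideal_gen (@eD_relators F m)).

Definition eD_gen (F : fieldType) (m : nat) (i : 'I_m.+1) : eD F m :=
  lie_pi (ideal_gen (@eD_relators F m)) (fl_gen F i).

Definition symp_form (F : fieldType) (n : nat) : 'M[F]_(n + n) :=
  block_mx 0 1%:M (- 1%:M) 0.

Definition sp_pred (F : fieldType) (n : nat) : {pred 'M[F]_(n + n)} :=
  fun A => A^T *m symp_form F n + symp_form F n *m A == 0.

Lemma sp_pred_submod (F : fieldType) (n : nat) : submod_closed (@sp_pred F n).
Proof.
split; first by rewrite unfold_in trmx0 mul0mx mulmx0 addr0.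
move=> a A B; rewrite !unfold_in => /eqP HA /eqP HB; apply/eqP.
rewrite linearP mulmxDl mulmxDr -scalemxAl -scalemxAr addrACA -scalerDr HA HB.
by rewrite scaler0 addr0.
Qed.

HB.instance Definition _ (F : fieldType) (n : nat) :=
  GRing.isSubmodClosed.Build F 'M[F]_(n + n) (@sp_pred F n)
    (GRing.submod_closed_semi (@sp_pred_submod F n)).

Record sp (F : fieldType) (n : nat) :=
  Sp { sp_val :> 'M[F]_(n + n); _ : sp_val \in @sp_pred F n }.

Section SymplecticLie.
Variables (F : fieldType) (n : nat).

HB.instance Definition _ := [isSub of sp F n for @sp_val F n].
HB.instance Definition _ := [Choice of sp F n by <:].
HB.instance Definition _ := [SubChoice_isSubLmodule of sp F n by <:].

Lemma sp_lie_subproof (A B : sp F n) :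
  (A : 'M[F]_(n + n)) *m B - (B : 'M[F]_(n + n)) *m A \in @sp_pred F n.
Proof.
move: (valP A) (valP B); rewrite !unfold_in /=.
move: (sp_val A) (sp_val B) => {}A {}B.
rewrite !addr_eq0 => /eqP HA /eqP HB.
rewrite linearB /= !trmx_mul mulmxBl mulmxBr -!mulmxA HA HB !mulmxN.
by rewrite !mulmxA HA HB !mulNmx !opprK opprB.
Qed.

Definition sp_lie (A B : sp F n) : sp F n := Sp (sp_lie_subproof A B).

Fact sp_linearl C : linear (fun A => sp_lie A C).
Proof.
move=> a A B; apply: val_inj; rewrite /= mulmxDl mulmxDr -scalemxAl -scalemxAr.
by rewrite scalerBr opprD addrACA.
Qed.

Fact sp_linearr C : linear (sp_lie C).
Proof.
move=> a A B; apply: val_inj; rewrite /= mulmxDl mulmxDr -scalemxAl -scalemxAr.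
by rewrite scalerBr opprD addrACA.
Qed.

Fact sp_liexx A : sp_lie A A = 0.
Proof. by apply: val_inj; rewrite /= subrr. Qed.

Fact sp_jacobi A B C :
  sp_lie A (sp_lie B C) + sp_lie B (sp_lie C A) + sp_lie C (sp_lie A B) = 0.
Proof.
apply: val_inj => /=; move: (sp_val A) (sp_val B) (sp_val C) => {}A {}B {}C.
rewrite !mulmxBr !mulmxBl !mulmxA.
apply/matrixP => i j; move: (A *m B *m C) (A *m C *m B) (B *m A *m C).
move: (B *m C *m A) (C *m A *m B) (C *m B *m A) => a b c d e f.
by rewrite !mxE; ring.
Qed.

HB.instance Definition _ := Lmodule_isLie.Build F (sp F n)
  sp_linearl sp_linearr sp_liexx sp_jacobi.

End SymplecticLie.

(* Main.v *)
(* Write d = e_1 - e_0 and f = (e_0 + e_1) / 2 (node 0 is \bar 1). The elements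
   x_0 = d, x_{j+1} = [e_{j+2}, x_j] span a copy of the standard representation:
   f, e_2, ..., e_m act on it by matrices of rank one. The two fork relations give
   [f, [f, e_2]] = - 2 f + [x_0, x_1] / 4, and since the rank one matrices satisfy
   this relation without the last term, [x_0, x_1] kills every x_j; acting by the
   e_k, so does every [x_i, x_j]. Hence J is spanned by the x_i and the [x_i, x_j]
   and is nilpotent of class at most 2.

   The quotient by J is an electrical Lie algebra of linear type; it is spanned by
   the iterated brackets [e_j, ..., [e_{i+1}, e_i]]. Sending e_k to a multiple of
   the square of a vector u_k, where consecutive u_k pair to 1 or -1 and all others
   pair to 0, maps this bracket to a multiple of u_i u_j in S^2(F^{2n}) = sp_{2n}.
   These products form a basis, so the map is an isomorphism.

   Finally, a nonzero ideal of sp_{2n} contains the square of a vector, and so do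
   all terms of its derived series; hence a solvable ideal maps to 0. *)
From HB Require Import structures.
Require Import Defs.
From mathcomp Require Import all_boot all_order all_algebra.
From mathcomp Require Import boolp classical_sets reals.
From mathcomp Require Import complex ring zify.

Set Implicit Arguments.
Unset Strict Implicit.
Unset Printing Implicit Defensive.

Import GRing.Theory.

Local Open Scope classical_set_scope.
Local Open Scope ring_scope.

(** * Brackets, subspaces and ideals *)

Section LieCalculus.
Variables (F : fieldType) (L : lieType F).
Implicit Types x y z : L.

HB.instance Definition _ z :=
  GRing.isLinear.Build F L L *:%R (@lie F L z) (lie_linearr z).

Lemma lieDr z x y : lie z (x + y) = lie z x + lie z y. Proof. exact: linearD. Qed.
Lemma lieNr z x : lie z (- x) = - lie z x. Proof. exact: linearN. Qed.
Lemma lieBr z x y : lie z (x - y) = lie z x - lie z y. Proof. exact: linearB. Qed.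
Lemma lieZr z a x : lie z (a *: x) = a *: lie z x. Proof. exact: linearZ. Qed.
Lemma lie0r z : lie z 0 = 0. Proof. exact: linear0. Qed.
Lemma lieNl z x : lie (- x) z = - lie x z.
Proof. by rewrite lieC lieNr opprK lieC. Qed.
Lemma lieDl z x y : lie (x + y) z = lie x z + lie y z.
Proof. by rewrite lieC lieDr opprD [lie x z]lieC [lie y z]lieC. Qed.
Lemma lieBl z x y : lie (x - y) z = lie x z - lie y z.
Proof. by rewrite lieDl lieNl. Qed.
Lemma lieZl z a x : lie (a *: x) z = a *: lie x z.
Proof. by rewrite lieC lieZr -scalerN -lieC. Qed.
Lemma lie0l z : lie 0 z = 0. Proof. by rewrite lieC lie0r oppr0. Qed.

Lemma lie_leibniz x y z : lie x (lie y z) = lie (lie x y) z + lie y (lie x z).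
Proof.
have /eqP := lie_jacobi x y z; rewrite -addrA addr_eq0 => /eqP ->.
by rewrite (lieC z x) (lieC z) lieNr -opprD opprK addrC.
Qed.

Lemma lie_lie x y z : lie (lie x y) z = lie x (lie y z) - lie y (lie x z).
Proof. by rewrite (lie_leibniz x) addrK. Qed.

Lemma lie_commute x y z : lie x y = 0 -> lie x (lie y z) = lie y (lie x z).
Proof. by move=> xy; rewrite lie_leibniz xy lie0l add0r. Qed.

Lemma lie_sym0 x y : lie x y = 0 -> lie y x = 0.
Proof. by move=> xy; rewrite lieC xy oppr0. Qed.


(** As [b] kills [x], both outer brackets fall on [a], turning it into [- 2 b], which kills [x]. *)
Lemma electrical_square0 a b x :
  lie b (lie b a) = - 2%:R *: b -> lie b x = 0 -> lie b (lie b (lie a x)) = 0.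
Proof.
move=> bba bx; have ->: lie b (lie a x) = lie (lie b a) x.
  by rewrite lie_leibniz bx lie0r addr0.
by rewrite lie_leibniz bba bx lie0r addr0 lieZl bx scaler0.
Qed.

(** Let both sides of [[a, [a, b]] = - 2 a] act on [x]: since [b x = 0], the left side is
    [- 2 a b a x + b a a x]. The correction [z] is 0 in all uses but [penult2]. *)
Lemma electrical_triple (two_neq0 : 2%:R != 0 :> F) a b x z :
  lie a (lie a b) = - 2%:R *: a -> lie b x = 0 ->
  lie a (lie a x) = - 2%:R *: z ->
  lie a (lie b (lie a x)) = lie a x - lie b z.
Proof.
move=> aab bx aax; have := congr1 (fun w => lie w x) aab.
rewrite !lie_lie bx lie0r sub0r lieNr aax !lieZr lieZl.
set t := lie a (lie b _); set u := lie a x; set w := lie b z => tE.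
apply: (scalerI two_neq0); rewrite scalerBr.
move: tE; rewrite -opprD !scaleNr opprK addrA -mulr2n -scaler_nat => /oppr_inj.
by move=> <-; rewrite addrK.
Qed.

End LieCalculus.

Section Subspaces.
Variables (F : fieldType) (L : lieType F).
Implicit Types S T I J : set L.

Lemma subspaceD T x y : is_subspace T -> T x -> T y -> T (x + y).
Proof. by move=> [_ H] Tx Ty; rewrite -[x]scale1r; apply: H. Qed.

Lemma subspaceZ T a x : is_subspace T -> T x -> T (a *: x).
Proof. by move=> [T0 H] Tx; rewrite -[a *: x]addr0; apply: H. Qed.

Lemma subspaceN T x : is_subspace T -> T x -> T (- x).
Proof. by move=> sT Tx; rewrite -scaleN1r; apply: subspaceZ. Qed.

Lemma subspaceB T x y : is_subspace T -> T x -> T y -> T (x - y).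
Proof. by move=> sT Tx Ty; apply: subspaceD => //; apply: subspaceN. Qed.

Lemma lie_span_subspace S : is_subspace (lie_span S).
Proof.
split=> [T [[]]//|a x y Sx Sy T [sT ST]].
by case: (sT) => _; apply; [apply: Sx|apply: Sy].
Qed.

Lemma lie_span_sub S T : is_subspace T -> S `<=` T -> lie_span S `<=` T.
Proof. by move=> sT ST x; apply. Qed.

Lemma sub_lie_span S : S `<=` lie_span S.
Proof. by move=> x Sx T [_]; apply. Qed.

Lemma subspace_lie_preim T z :
  is_subspace T -> is_subspace [set x | T (lie z x)].
Proof.
move=> sT; split=> /= [|a x y Tx Ty]; first by rewrite lie0r; case: sT.
by rewrite lieDr lieZr; apply: (proj2 sT).
Qed.

Lemma lie_span_bilinear S1 S2 T : is_subspace T ->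
  (forall x y, S1 x -> S2 y -> T (lie x y)) ->
  forall x y, lie_span S1 x -> lie_span S2 y -> T (lie x y).
Proof.
move=> sT H x y S1x S2y; move: x S1x.
apply: lie_span_sub => [|x S1x].
  split=> [|a u v Tu Tv] /=; first by rewrite lie0l; case: sT.
  by rewrite liePl; apply: (proj2 sT).
move: y S2y; apply: lie_span_sub => [|y S2y]; last exact: H.
exact: subspace_lie_preim.
Qed.

Lemma subspace_set0 : is_subspace [set (0 : L)].
Proof. by split=> // a x y -> ->; rewrite scaler0 addr0. Qed.

Definition stabilizes T : set L := [set w | forall v, T v -> T (lie w v)].

Lemma stabilizes_subspace T : is_subspace T -> is_subspace (stabilizes T).
Proof.
move=> sT; split=> [v _|a x y Hx Hy v Tv]; first by rewrite lie0l; case: sT.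
by rewrite liePl; apply: (proj2 sT); [apply: Hx|apply: Hy].
Qed.

(** With [stabilizes_subspace] this makes the stabilizer a Lie subalgebra, so invariance of a
    subspace need only be checked on generators. *)
Lemma stabilizes_lie T x y : is_subspace T ->
  stabilizes T x -> stabilizes T y -> stabilizes T (lie x y).
Proof.
move=> sT Hx Hy v Tv.
by rewrite lie_lie; apply: subspaceB => //; [apply/Hx/Hy|apply/Hy/Hx].
Qed.

Lemma stabilizes_span S z :
  (forall v, S v -> lie_span S (lie z v)) -> stabilizes (lie_span S) z.
Proof.
move=> H; apply: lie_span_sub => //.
exact: subspace_lie_preim (lie_span_subspace S).
Qed.

Lemma lie_prod_sub I J T : is_subspace T ->
  (forall x y, I x -> J y -> T (lie x y)) -> lie_prod I J `<=` T.
Proof. by move=> sT H; apply: lie_span_sub => // _ [x Ix [y Jy <-]]; apply: H. Qed.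

Lemma lie_prod_ideal I J : is_ideal I -> is_ideal J -> is_ideal (lie_prod I J).
Proof.
move=> [sI lI] [sJ lJ]; split=> [|z]; first exact: lie_span_subspace.
apply: (stabilizes_span (z := z)) => _ [x Ix [y Jy <-]]; rewrite lie_leibniz.
apply: (subspaceD (lie_span_subspace _)).
  by apply: sub_lie_span; exists (lie z x); [exact: lI|exists y].
by apply: sub_lie_span; exists x => //; exists (lie z y); first exact: lJ.
Qed.

Lemma derived_ideal I k : is_ideal I -> is_ideal (derived I k).
Proof. by move=> idI; elim: k => //= k IH; apply: lie_prod_ideal. Qed.

End Subspaces.

(** * The ideal of the fork *)

(* The indices start at 0; [x] behaves like the basis of the standard
   representation on which [g k] acts as a matrix of rank one. *)
Section ChainAction.
Variables (F : fieldType) (L : lieType F) (m : nat) (g x : nat -> L).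
Hypothesis two_neq0 : 2%:R != 0 :> F.
Hypothesis gC : forall i j, (i.+1 < j)%N -> (j < m)%N -> lie (g i) (g j) = 0.
Hypothesis gA : forall i, (0 < i)%N -> (i.+1 < m)%N ->
  lie (g i) (lie (g i) (g i.+1)) = - 2%:R *: g i.
Hypothesis gB : forall i, (0 < i)%N -> (i.+1 < m)%N ->
  lie (g i.+1) (lie (g i.+1) (g i)) = - 2%:R *: g i.+1.
Hypothesis x0 : forall k, (k < m)%N -> k != 1%N -> lie (g k) (x 0) = 0.
Hypothesis xS : forall j, (j.+1 < m)%N -> x j.+1 = lie (g j.+1) (x j).
Hypothesis g1x1 : lie (g 1) (x 1) = 0.
Hypothesis g0x1 : lie (g 0) (x 1) = x 0.

Let far j k : (j.+1 < k)%N -> (k < m)%N -> lie (g k) (x j) = 0.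
Proof.
elim: j => [|j IH] jk km; first by apply: x0 => //; lia.
rewrite xS; last lia.
rewrite lie_commute ?IH ?lie0r //; try lia.
by apply/lie_sym0/gC.
Qed.

Let same j : (j < m)%N -> lie (g j) (x j) = 0.
Proof.
case: j => [|[|j]] jm; [exact: x0|exact: g1x1|].
by rewrite xS // xS ?electrical_square0 ?gB ?far //; lia.
Qed.

(** For positive [j] this is [electrical_triple] with [a = g j], [b = g j.+1] and [z = 0], because
    [g j] squares to zero on [x j.-1] by [same]. *)
Let back j : (j.+1 < m)%N -> lie (g j) (x j.+1) = x j.
Proof.
case: j => [|j] jm; first exact: g0x1.
rewrite xS // [x j.+1]xS; last lia.
rewrite (@electrical_triple _ _ two_neq0 _ _ _ 0) ?lie0r ?subr0 //.
- exact: gA.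
- exact: far.
by rewrite -xS ?same ?scaler0 //; lia.
Qed.

Let low k j : (k.+1 < j)%N -> (j < m)%N -> lie (g k) (x j) = 0.
Proof.
elim: j => // j IH kj jm; rewrite xS // lie_commute ?gC //.
(* For [j = k.+1] the inner bracket is [x k] by [back], which [g k.+2] kills. *)
have [->|kj'] := eqVneq j k.+1; last by rewrite IH ?lie0r //; lia.
by rewrite back ?far //; lia.
Qed.

Lemma chain_action k j : (k < m)%N -> (j < m)%N ->
  lie (g k) (x j) = if (k == j.+1) || (j == k.+1) then x k else 0.
Proof.
move=> km jm; case: ifP => [/orP[]/eqP kj|/negbT]; subst.
- by rewrite xS.
- exact: back.
rewrite negb_or => /andP[kj jk].
have [->|[|]] : k = j \/ (j.+1 < k)%N \/ (k.+1 < j)%N by lia.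
- exact: same.
- by move=> ?; apply: far.
- by move=> ?; apply: low.
Qed.

Hypothesis m_gt1 : (1 < m)%N.
Hypothesis x01x : forall l, (l < m)%N -> lie (lie (x 0) (x 1)) (x l) = 0.

(** The annihilator [Z] of all [x l] is stable under each [g k], because [g k] maps every [x l] to
    some [x] or to 0. Starting from [[x 0, x 1]], the [g k] first raise the second index and then
    the first. *)
Lemma chain_nilpotent i j l : (i < m)%N -> (j < m)%N -> (l < m)%N ->
  lie (lie (x i) (x j)) (x l) = 0.
Proof.
pose Z z := forall l, (l < m)%N -> lie z (x l) = 0.
have Zg k z : (k < m)%N -> Z z -> Z (lie (g k) z).
  move=> km Zz q qm; have := lie_leibniz (g k) z (x q).
  rewrite Zz // lie0r chain_action // => /esym; case: ifP => _.
    by rewrite Zz // addr0.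
  by rewrite lie0r addr0.
have ZD z t : Z z -> Z (z + t) -> Z t.
  by move=> Zz Zzt q qm; have := Zzt q qm; rewrite lieDl Zz // add0r.
suff H p q : (p < q)%N -> (q < m)%N -> Z (lie (x p) (x q)).
  move=> im jm lm; have [->|] := eqVneq i j; first by rewrite liexx lie0l.
  rewrite neq_ltn => /orP[] ij; first exact: H.
  by rewrite (lieC (x i)) lieNl H ?oppr0.
elim: p q => [|p IH] q; last first.
  (* Bracketing with [g p.+1] raises [x p]; the other term is [[x p, x p.+1]] if [q = p.+2] and 0
     otherwise, so it lies in [Z] and can be subtracted. *)
  move=> pq qm; have /(Zg p.+1) := IH q ltac:(lia) qm.
  rewrite lie_leibniz -xS; last lia.
  rewrite chain_action ?(leq_trans pq) //; try lia.
  case: ifP => [_|_]; last by rewrite lie0r addr0; apply; lia.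
  rewrite addrC => H; apply: ZD (IH p.+1 _ _) (H _); lia.
elim: q => // -[|q] IH _ qm; first exact: x01x.
have /(Zg q.+2) := IH isT ltac:(lia).
by rewrite lie_leibniz -xS // x0 // lie0l add0r; apply; lia.
Qed.

End ChainAction.

Section ForkIdeal.
Variables (F : fieldType) (L : lieType F) (m : nat) (e : nat -> L).
Hypothesis two_neq0 : 2%:R != 0 :> F.
Hypothesis m_gt1 : (1 < m)%N.
Hypothesis e01 : lie (e 0) (e 1) = 0.
Hypothesis eC : forall i j, (i.+1 < j)%N -> (j <= m)%N ->
  ~~ ((i == 0) && (j == 2)) -> lie (e i) (e j) = 0.
Hypothesis e02 : lie (e 0) (lie (e 0) (e 2)) = - 2%:R *: e 0.
Hypothesis e20 : lie (e 2) (lie (e 2) (e 0)) = - 2%:R *: e 2.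
Hypothesis eA : forall i, (0 < i)%N -> (i < m)%N ->
  lie (e i) (lie (e i) (e i.+1)) = - 2%:R *: e i.
Hypothesis eB : forall i, (0 < i)%N -> (i < m)%N ->
  lie (e i.+1) (lie (e i.+1) (e i)) = - 2%:R *: e i.+1.

Let s := e 0 + e 1.
Let g k := if k is k'.+1 then e k'.+2 else 2%:R^-1 *: s.
Let x := fix x j := if j is j'.+1 then lie (g j'.+1) (x j') else e 1 - e 0.

(** Both sides are [[[e 0, e 2], e 1]]; this makes the mixed terms cancel in [sx1]. *)
Let cross : lie (e 0) (lie (e 2) (e 1)) = lie (e 1) (lie (e 2) (e 0)).
Proof.
by rewrite lie_leibniz e01 lie0r addr0 (lieC _ (e 1)) (lieC (e 0)) lieNr opprK.
Qed.

Let e020 : lie (e 0) (lie (e 2) (e 0)) = 2%:R *: e 0.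
Proof. by rewrite (lieC (e 2)) lieNr e02 scaleNr opprK. Qed.

Let e121 : lie (e 1) (lie (e 2) (e 1)) = 2%:R *: e 1.
Proof. by rewrite (lieC (e 2)) lieNr eA // scaleNr opprK. Qed.

Let gC i j : (i.+1 < j)%N -> (j < m)%N -> lie (g i) (g j) = 0.
Proof.
case: j => // j ij jm; case: i ij => [|i] ij /=; last by apply: eC; lia.
rewrite lieZl lieDl !eC ?addr0 ?scaler0 //; lia.
Qed.

Let x0 k : (k < m)%N -> k != 1%N -> lie (g k) (x 0) = 0.
Proof.
case: k => [|[//|k]] km _ /=; last first.
  by rewrite lieBr !(lie_sym0 (eC _ _ _)) ?subr0 //; lia.
by rewrite lieZl lieDl !lieBr !liexx e01 (lie_sym0 e01) !subr0 addr0 scaler0.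
Qed.

Let g1x1 : lie (g 1) (x 1) = 0.
Proof. by rewrite /= !lieBr e20 eB ?subrr. Qed.

Let sx1 : lie s (x 1) = 2%:R *: x 0.
Proof.
rewrite /= lieDl !lieBr cross e020 e121 scalerBr.
by rewrite addrC addrA subrK.
Qed.

Let g0x1 : lie (g 0) (x 1) = x 0.
Proof. by rewrite lieZl sx1 scalerA mulVf // scale1r. Qed.

Let gx k j : (k < m)%N -> (j < m)%N ->
  lie (g k) (x j) = if (k == j.+1) || (j == k.+1) then x k else 0.
Proof.
apply: chain_action => // i; first by case: i => // i _ im; apply: eA.
by case: i => // i _ im; apply: eB.
Qed.

(** This is the relation for [[f, [f, e_2]]] with denominators cleared by [s = 2 f]. *)
Let x01E : lie (x 0) (x 1) = lie s (lie s (e 2)) + 4%:R *: s.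
Proof.
rewrite /= !lieBr !lieBl cross e020 e121.
rewrite [lie s (e 2)]lieC lieNr !lieDr !lieDl cross e020 e121.
have -> : 4%:R *: s = 2%:R *: s + 2%:R *: s by rewrite -scalerDl -natrD.
rewrite !scalerDr.
set t := lie _ _; move: (2%:R *: e 0) (2%:R *: e 1) => a b.
rewrite [t + b]addrC [(a + t) + _]addrACA [RHS]addrC.
rewrite [- (a + b + _)]opprD addrA addrK.
by rewrite opprB addrACA -opprD [b + a]addrC.
Qed.

Let sx k : (k < m)%N -> lie s (x k) = if k == 1%N then 2%:R *: x 0 else 0.
Proof.
move=> km; have := gx (ltnW m_gt1) km; rewrite lieZl => sk.
apply: (scalerI (invr_neq0 two_neq0)); rewrite sk.
by case: k {km sk} => [|[|k]] //=; rewrite ?scaler0 // scalerA mulVf ?scale1r.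
Qed.

Let e2x k : (k < m)%N ->
  lie (e 2) (x k) = if (k == 0) || (k == 2) then x 1 else 0.
Proof. by move=> km; rewrite -[e 2]/(g 1) gx //; case: k km. Qed.

(** Among the [x l], [s] moves only [x 1], to [2 x 0], and [e 2] moves only [x 0] and [x 2], to
    [x 1]; so the right side of [x01E] acts as 0. *)
Let x01x l : (l < m)%N -> lie (lie (x 0) (x 1)) (x l) = 0.
Proof.
move=> lm; have m0 := ltnW m_gt1.
rewrite x01E lieDl lieZl !lie_lie.
have [l2|l2] := ltnP 2 l.
  rewrite !sx // !e2x //; case: l l2 lm => [|[|[|l]]] //= *.
  by rewrite !(lie0r, subr0, scaler0, addr0).
have s0 : lie s (x 0) = 0 by exact: (sx (ltnW m_gt1)).
have s1 : lie s (x 1) = 2%:R *: x 0 by exact: sx1.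
have c0 : lie (e 2) (x 0) = x 1 by [].
have c1 : lie (e 2) (x 1) = 0 by exact: g1x1.
have s2 : (2 < m)%N -> lie s (x 2) = 0 by exact: sx.
have c2 : (2 < m)%N -> lie (e 2) (x 2) = x 1 by exact: e2x.
case: l l2 lm => [|[|[|//]]] _ lm;
  move: (x 0) (x 1) (x 2) s0 s1 c0 c1 s2 c2 => y0 y1 y2 s0 s1 c0 c1 s2 c2.
- by rewrite !(s0, c0, s1, lieZr, lie0r, subr0, scaler0, addr0).
(* The double bracket contributes [- 8 x 0] and the term [4 s] contributes [8 x 0]. *)
- rewrite !(s0, s1, c0, c1, lieZr, lie0r, subr0, sub0r, scaler0, addr0, lieNr).
  rewrite !scalerA -!scaleNr -!scalerDl -[RHS](scale0r y0).
  congr (_ *: _); ring.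
- by rewrite s2 // c2 // !(s1, s0, lie0r, lieZr, subr0, oppr0, scaler0, addr0).
Qed.

Let xxx i j l : (i < m)%N -> (j < m)%N -> (l < m)%N ->
  lie (lie (x i) (x j)) (x l) = 0.
Proof.
apply: (chain_nilpotent (g := g)) => // k; case: k => // k _ km.
  exact: eA.
exact: eB.
Qed.

Let Y : set L :=
  [set y | exists i j, [/\ (i < m)%N, (j < m)%N & y = lie (x i) (x j)]].
Let X : set L := [set y | exists2 i, (i < m)%N & y = x i].

Hypothesis e_gen : forall P : set L, is_subspace P ->
  (forall u v, P u -> P v -> P (lie u v)) ->
  (forall k, (k <= m)%N -> P (e k)) -> forall u, P u.

Lemma subspace_ideal (T : set L) : is_subspace T ->
  (forall k v, (k <= m)%N -> T v -> T (lie (e k) v)) -> is_ideal T.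
Proof.
move=> sT eT; split=> // u; apply: (e_gen (P := stabilizes T)) => [|v w|k km v].
- exact: stabilizes_subspace.
- exact: stabilizes_lie.
- exact: eT.
Qed.

(** Each [g k] preserves the span by the derivation rule; [x 0] maps [X] into [Y] and kills [Y].
    This covers all generators, as [e 0] and [e 1] are [g 0] minus and plus [x 0 / 2]. *)
Let XY_ideal : is_ideal (lie_span (X `|` Y)).
Proof.
have sM := lie_span_subspace (X `|` Y).
have Xx i : (i < m)%N -> lie_span (X `|` Y) (x i).
  by move=> im; apply: sub_lie_span; left; exists i.
have Yx i j : (i < m)%N -> (j < m)%N -> lie_span (X `|` Y) (lie (x i) (x j)).
  by move=> im jm; apply: sub_lie_span; right; exists i, j.
have gM k : (k < m)%N -> stabilizes (lie_span (X `|` Y)) (g k).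
  move=> km; apply: stabilizes_span => _ [[j jm ->]|[i [j [im jm ->]]]].
    by rewrite gx //; case: ifP => _; [exact: Xx|case: sM].
  rewrite lie_leibniz !gx //; apply: (subspaceD sM).
    by case: ifP => _; [exact: Yx|rewrite lie0l; case: sM].
  by case: ifP => _; [exact: Yx|rewrite lie0r; case: sM].
have xM : stabilizes (lie_span (X `|` Y)) (x 0).
  apply: stabilizes_span => _ [[j jm ->]|[i [j [im jm ->]]]].
    by apply: Yx => //; lia.
  by rewrite (lieC (x 0)) xxx ?oppr0; [case: sM|lia..].
apply: subspace_ideal => // k v km.
have sS := stabilizes_subspace sM.
have fM := gM 0 (ltnW m_gt1).
have sE : 2%:R *: (2%:R^-1 *: s) = s by rewrite scalerA mulfV ?scale1r.
have [e0E e1E] : e 0 = g 0 - 2%:R^-1 *: x 0 /\ e 1 = g 0 + 2%:R^-1 *: x 0.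
  split; apply: (scalerI two_neq0);
    rewrite ?(scalerBr _ (g 0)) ?(scalerDr _ (g 0)) sE scalerA mulfV //
      scale1r scaler_nat mulr2n.
    by rewrite /s /= opprB addrACA subrr addr0.
  by rewrite /s /= [RHS]addrC addrA subrK.
suff: stabilizes (lie_span (X `|` Y)) (e k) by apply.
case: k km => [|[|k]] km; last by apply: (gM k.+1).
  by rewrite e0E; apply: (subspaceB sS) => //; apply: (subspaceZ _ sS).
by rewrite e1E; apply: (subspaceD sS) => //; apply: (subspaceZ _ sS).
Qed.

(** The span of [Y] commutes with [X], hence with itself; so the first derived term of the ideal
    lies in it and the second vanishes. *)
Lemma fork_ideal_solvable : solvable (ideal_gen [set e 1 - e 0]).
Proof.
have sY := lie_span_subspace Y; have sXY := lie_span_subspace (X `|` Y).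
have YX := lie_span_bilinear (S1 := Y) (S2 := X) (subspace_set0 L).
have YY := lie_span_bilinear (S1 := Y) (S2 := Y) (subspace_set0 L).
have {}YX y z : lie_span Y y -> lie_span X z -> lie y z = 0.
  by apply: YX => _ _ [i [j [im jm ->]]] [k km ->]; rewrite /= xxx.
have {}YY y z : lie_span Y y -> lie_span Y z -> lie y z = 0.
  apply: YY => {}y _ /sub_lie_span Yy [i [j [im jm ->]]] /=.
  have Xx k : (k < m)%N -> lie_span X (x k).
    by move=> km; apply: sub_lie_span; exists k.
  rewrite lie_leibniz (YX _ _ Yy (Xx _ im)) (YX _ _ Yy (Xx _ jm)).
  by rewrite lie0l lie0r addr0.
set J := ideal_gen _.
have JXY : J `<=` lie_span (X `|` Y).
  move=> v; apply; split; first exact: XY_ideal.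
  move=> _ ->; apply: sub_lie_span; left.
  by exists 0 => //; lia.
have D1 : derived J 1 `<=` lie_span Y.
  apply: (lie_prod_sub sY) => u v /JXY Xu /JXY Xv; move: u v Xu Xv.
  apply: lie_span_bilinear => // u v.
  move=> [Xu|/sub_lie_span Yu] [Xv|/sub_lie_span Yv].
  - case: Xu Xv => i im -> [j jm ->]; apply: sub_lie_span.
    by exists i, j.
  - by rewrite lieC YX ?oppr0; [case: sY| |apply: sub_lie_span].
  - by rewrite YX; [case: sY| |apply: sub_lie_span].
  - by rewrite YY //; case: sY.
exists 2; apply/seteqP; split=> [|_ ->]; last first.
  by case: (lie_span_subspace _ : is_subspace (derived J 2)).
by apply: lie_prod_sub (subspace_set0 L) _ => u v /D1 Yu /D1 Yv; apply: YY.
Qed.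
End ForkIdeal.

(** * Electrical Lie algebras of linear type *)

Section LinearChain.
Variables (F : fieldType) (L : lieType F) (m : nat) (e : nat -> L).
Hypothesis two_neq0 : 2%:R != 0 :> F.
Hypothesis eC : forall i j, (i.+1 < j)%N -> (j < m)%N -> lie (e i) (e j) = 0.
Hypothesis eA : forall i, (i.+1 < m)%N ->
  lie (e i) (lie (e i) (e i.+1)) = - 2%:R *: e i.
Hypothesis eB : forall i, (i.+1 < m)%N ->
  lie (e i.+1) (lie (e i.+1) (e i)) = - 2%:R *: e i.+1.
Hypothesis e_gen : forall P : set L, is_subspace P ->
  (forall u v, P u -> P v -> P (lie u v)) ->
  (forall k, (k < m)%N -> P (e k)) -> forall u, P u.

(** The counterpart of the root vector for [alpha_i + ... + alpha_(i+d)] in type A. Indexing by the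
    offset [d] makes the recursion structural. *)
Fixpoint chain_root (i d : nat) : L :=
  if d is d'.+1 then lie (e (i + d)) (chain_root i d') else e i.

Let yS i d : chain_root i d.+1 = lie (e (i + d.+1)) (chain_root i d).
Proof. by []. Qed.

(** From here to [middle], the action of [e k] on [chain_root i d] is tabulated by the position of
    [k] relative to the two ends of the chain. *)
Let above k i d : (i + d.+1 < k)%N -> (k < m)%N -> lie (e k) (chain_root i d) = 0.
Proof.
elim: d => [|d IH] ik km; first by apply/lie_sym0/eC; lia.
rewrite yS lie_commute ?IH ?lie0r //; first lia.
by apply/lie_sym0/eC; lia.
Qed.

Let below k i d : (k.+1 < i)%N -> (i + d < m)%N -> lie (e k) (chain_root i d) = 0.
Proof.
elim: d => [|d IH] ki im; first by apply: eC; lia.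
by rewrite yS lie_commute ?IH ?lie0r ?eC //; lia.
Qed.

Let before k d : (k + d.+1 < m)%N ->
  lie (e k) (chain_root k.+1 d) = - chain_root k d.+1.
Proof.
elim: d => [|d IH] km; first by rewrite /= lieC addn1.
rewrite yS lie_commute ?eC //; try lia.
by rewrite IH ?lieNr ?addSnnS //; lia.
Qed.

Let first1 i : (i.+1 < m)%N -> lie (e i) (chain_root i 1) = 2%:R *: e i.
Proof.
by move=> im; rewrite /= addn1 (lieC (e i.+1)) lieNr eA // scaleNr opprK.
Qed.

Let first2 i d : (i + d.+2 < m)%N -> lie (e i) (chain_root i d.+2) = 0.
Proof.
elim: d => [|d IH] im; rewrite yS lie_commute ?eC //; try lia.
  by rewrite first1 ?lieZr ?(lie_sym0 (eC _ _)) ?scaler0 //; lia.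
by rewrite IH ?lie0r //; lia.
Qed.

Let last i d : (i + d.+2 < m)%N -> lie (e (i + d.+2)) (chain_root i d.+2) = 0.
Proof.
move=> im; rewrite yS yS electrical_square0 ?above //; try lia.
by rewrite !addnS eB //; lia.
Qed.

Let second1 i : (i.+1 < m)%N ->
  lie (e i.+1) (chain_root i 1) = - 2%:R *: e i.+1.
Proof. by move=> im; rewrite /= addn1 eB. Qed.

(** Here [[e i.+1, [e i.+1, e i]]] is [- 2 e i.+1] and not 0, so [electrical_triple] keeps its
    second term with [z = e i.+1]. *)
Let penult2 i : (i.+2 < m)%N ->
  lie (e i.+1) (chain_root i 2) = chain_root i 1 - chain_root i.+1 1.
Proof.
move=> im; rewrite yS yS /= !addn1 addn2.
by apply: electrical_triple; rewrite ?eA ?eB ?(lie_sym0 (eC _ _)) //; lia.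
Qed.

Let penult i d : (i + d.+3 < m)%N ->
  lie (e (i + d.+2)) (chain_root i d.+3) = chain_root i d.+2.
Proof.
move=> im; rewrite yS [chain_root i d.+2]yS.
rewrite (@electrical_triple _ _ two_neq0 _ _ _ 0) ?lie0r ?subr0 //.
- by rewrite [(i + d.+3)%N]addnS eA //; lia.
- by rewrite above //; lia.
by rewrite -yS last ?scaler0 //; lia.
Qed.

(** The sign and the shift come from the second term of [penult2]; its first term is killed by
    [e i.+3], and later brackets only extend the chain. *)
Let second i d : (i + d.+3 < m)%N ->
  lie (e i.+1) (chain_root i d.+3) = - chain_root i.+1 d.+2.
Proof.
elim: d => [|d IH] im; rewrite yS lie_commute ?eC //; try lia.
  rewrite penult2 ?lieBr; last lia.
  by rewrite [chain_root i.+1 2]yS addSnnS above ?sub0r //; lia.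
by rewrite [chain_root i.+1 d.+3]yS addSnnS IH ?lieNr //; lia.
Qed.

Let middle k i d : (i.+1 < k)%N -> (k.+1 < i + d)%N -> (i + d < m)%N ->
  lie (e k) (chain_root i d) = 0.
Proof.
elim: d => [|d IH] ik kd im; first lia.
rewrite yS lie_commute ?eC //; try lia.
(* If the shorter chain ends at [k.+1], [penult] cuts that end off and the outer generator [e k.+2]
   kills the rest. *)
have [kE|kd'] := eqVneq k.+1 (i + d)%N; last by rewrite IH ?lie0r //; lia.
have [c dE] : exists c, d = c.+3 by exists (d - 3)%N; lia.
have -> : k = (i + c.+2)%N by lia.
by rewrite dE penult ?above //; lia.
Qed.

(** By the table above the span of the chains is stable under the [e k], hence under the whole
    algebra; as it contains the [e k], it is everything. *)
Lemma chain_root_span (P : set L) : is_subspace P ->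
  (forall i d, (i + d < m)%N -> P (chain_root i d)) -> forall u, P u.
Proof.
move=> sP Py.
pose T := lie_span [set y | exists i d, (i + d < m)%N /\ y = chain_root i d].
have sT : is_subspace T by apply: lie_span_subspace.
have T0 : T 0 by case: sT.
have Ty i d : (i + d < m)%N -> T (chain_root i d).
  by move=> im; apply: sub_lie_span; exists i, d.
have Te i : (i < m)%N -> T (e i) by move=> im; apply: (Ty i 0); rewrite addn0.
suff TT u : T u.
  move=> u; move: u (TT u); apply: lie_span_sub => // _ [i [d [im ->]]].
  exact: Py.
have eT k : (k < m)%N -> stabilizes T (e k).
  move=> km; apply: stabilizes_span => _ [i [d [im ->]]]; rewrite -/T.
  have [ki|ik] := ltnP k i.
    have [kE|ki'] := eqVneq k.+1 i; last by rewrite below //; lia.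
    subst i; rewrite before; last lia.
    by apply: (subspaceN sT); apply: Ty; lia.
  have [kd|dk] := ltnP (i + d) k.
    have [kE|ki'] := eqVneq k (i + d.+1)%N; last by rewrite above //; lia.
    by rewrite kE -yS; apply: Ty; lia.
  have [kE|ki] := eqVneq k i.
    subst k; case: d im dk => [|[|d]] im dk.
    - by rewrite /= liexx.
    - by rewrite first1; [apply: (subspaceZ _ sT); apply: Te; lia|lia].
    - by rewrite first2.
  have [kE|ki1] := eqVneq k i.+1.
    subst k; case: d im dk => [|[|[|d]]] im dk; first lia.
    - by rewrite second1; [apply: (subspaceZ _ sT); apply: Te; lia|lia].
    - by rewrite penult2; [apply: (subspaceB sT); apply: Ty; lia|lia].
    - by rewrite second //; apply: (subspaceN sT); apply: Ty; lia.
  have [kd|kd] := eqVneq k (i + d)%N.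
    have [c dE] : exists c, d = c.+2 by exists (d - 2)%N; lia.
    by rewrite kd dE last //; lia.
  have [kd1|kd1] := eqVneq k.+1 (i + d)%N.
    have [c dE] : exists c, d = c.+3 by exists (d - 3)%N; lia.
    have -> : k = (i + c.+2)%N by lia.
    by rewrite dE penult; [apply: Ty; lia|lia].
  by rewrite middle //; lia.
have sL : forall u, stabilizes T u.
  apply: e_gen => //; first exact: stabilizes_subspace.
  by move=> v w; apply: stabilizes_lie.
apply: e_gen => // v w Tv Tw; exact: sL.
Qed.

End LinearChain.

(** * The symplectic Lie algebra as a symmetric square *)

Section Symplectic.
Variables (F : fieldType) (n : nat).
Hypothesis two_neq0 : 2%:R != 0 :> F.
Local Notation Om := (symp_form F n).
Implicit Types (a b c v w : 'cV[F]_(n + n)) (A : sp F n).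

Definition symp a b : F := (a^T *m Om *m b) 0 0.

Lemma symp_formT : Om^T = - Om.
Proof.
rewrite /symp_form tr_block_mx !trmx0 !linearN /= trmx1 (opp_block_mx 0 1%:M).
by rewrite !oppr0 opprK.
Qed.

Lemma symp_form_sqr : Om *m Om = - 1%:M.
Proof.
rewrite /symp_form mulmx_block !mulmx0 !mul0mx !mulmxN !mulNmx !mulmx1.
by rewrite !add0r addr0 scalar_mx_block opp_block_mx !oppr0.
Qed.

Lemma symp_form_unit : Om \in unitmx.
Proof.
suff /mulmx1_unit[] : Om *m - Om = 1%:M by [].
by rewrite mulmxN symp_form_sqr opprK.
Qed.

Lemma sympC a b : symp a b = - symp b a.
Proof.
rewrite /symp -[in LHS](trmxK (a^T *m Om *m b)) mxE !trmx_mul symp_formT trmxK.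
by rewrite mulNmx mulmxN mulmxA !mxE.
Qed.

Lemma sympxx a : symp a a = 0.
Proof.
apply: (mulfI two_neq0); rewrite mulr0 mulr_natl mulr2n {1}sympC addNr //.
Qed.

Lemma symp_sumE a b : symp a b =
  \sum_(r < n) (a (lshift n r) 0 * b (rshift n r) 0 -
                a (rshift n r) 0 * b (lshift n r) 0).
Proof.
rewrite /symp -[a]vsubmxK -[b]vsubmxK tr_col_mx.
rewrite mul_row_block mul_row_col !mulmx0 mulmx1 mulmxN mulmx1 add0r addr0.
rewrite !mxE -big_split /= ; apply: eq_bigr => r _.
by rewrite !mxE !(unsplitK (inl _)) !(unsplitK (inr _)) !mxE addrC mulNr.
Qed.

Lemma sym_sq_subproof a b :
  a *m b^T *m Om + b *m a^T *m Om \in @sp_pred F n.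
Proof.
rewrite unfold_in linearD /= !trmx_mul !trmxK symp_formT mulmxDl mulmxDr.
by rewrite !mulNmx !mulmxA -opprD addrC subr_eq0 addrC.
Qed.

(** The product of [a] and [b] in the symmetric square; it maps [v] to
    [symp b v *: a + symp a v *: b]. *)
Definition sym_sq a b : sp F n := Sp (sym_sq_subproof a b).

Lemma sym_sqC a b : sym_sq a b = sym_sq b a.
Proof. by apply: val_inj; rewrite /= addrC. Qed.

Lemma sym_sqZl k a b : sym_sq (k *: a) b = k *: sym_sq a b.
Proof.
by apply: val_inj; rewrite /= linearZ /= -!(scalemxAl, scalemxAr) scalerDr.
Qed.

Lemma sym_sqZr k a b : sym_sq a (k *: b) = k *: sym_sq a b.
Proof. by rewrite sym_sqC sym_sqZl sym_sqC. Qed.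

Lemma sym_sq0l b : sym_sq 0 b = 0.
Proof. by rewrite -(scale0r (0 : 'cV_(n + n))) sym_sqZl scale0r. Qed.

Lemma sym_sq0r b : sym_sq b 0 = 0.
Proof. by rewrite sym_sqC sym_sq0l. Qed.

Lemma sp_trmx A : (sp_val A)^T *m Om = - (Om *m sp_val A).
Proof. by apply/eqP; rewrite -addr_eq0; apply: (valP A). Qed.

Lemma lie_sym_sq A a b :
  lie A (sym_sq a b) = sym_sq (sp_val A *m a) b + sym_sq a (sp_val A *m b).
Proof.
have OA : Om *m sp_val A = - ((sp_val A)^T *m Om) by rewrite sp_trmx opprK.
apply: val_inj => /=; rewrite !trmx_mul mulmxDr mulmxDl opprD.
rewrite -![_ *m Om *m sp_val A]mulmxA OA !mulmxN !opprK !mulmxA.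
set x := _ *m _; set y := _ *m _; set z := _ *m _; set t := _ *m _.
by rewrite [z + t]addrC addrACA [y + z]addrC.
Qed.

Lemma sym_sq_mul v a : sp_val (sym_sq v v) *m a = (2%:R * symp v a) *: v.
Proof.
rewrite /= mulmxDl -mulr2n -!mulmxA [v^T *m _]mulmxA [v^T *m _ *m _]mx11_scalar.
by rewrite mul_mx_scalar mulr_natl scalerMnl.
Qed.

(** The inner bracket is [- 2] times the product of [A v] and [v]; the square of [v] kills [v] and
    maps [A v] to a multiple of [v]. *)
Lemma sym_sq_lie2 v A :
  lie (sym_sq v v) (lie (sym_sq v v) A) =
  - (4%:R * symp v (sp_val A *m v)) *: sym_sq v v.
Proof.
rewrite (lieC _ A) lie_sym_sq (sym_sqC _ v) -mulr2n -scaler_nat lieNr lieZr.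
rewrite lie_sym_sq !sym_sq_mul sympxx mulr0 scale0r sym_sq0l add0r sym_sqZr scalerA.
rewrite scaleNr mulrA.
by rewrite -natrM.
Qed.

Lemma sympDl a b c : symp (a + b) c = symp a c + symp b c.
Proof. by rewrite /symp linearD /= !mulmxDl mxE. Qed.

Lemma sympDr a b c : symp c (a + b) = symp c a + symp c b.
Proof. by rewrite /symp mulmxDr mxE. Qed.

Lemma sp_symp A a b : symp a (sp_val A *m b) = symp b (sp_val A *m a).
Proof.
rewrite sympC {1}/symp trmx_mul -(mulmxA b^T) sp_trmx mulmxN mulNmx.
rewrite [in LHS]mxE opprK /symp.
by rewrite !mulmxA.
Qed.

(** The bilinear form [symp a (A b)] is symmetric by [sp_symp]. If its quadratic form vanished,
    polarization would make it zero, and [A] too since [symp_form] is invertible. *)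
Lemma sp_form_neq0 A : A != 0 -> exists v, symp v (sp_val A *m v) != 0.
Proof.
apply: contraNP => /forallNP A0.
have {}A0 v : symp v (sp_val A *m v) = 0.
  by apply/eqP; apply: contrapT => /negP; apply: A0.
have S0 a b : symp a (sp_val A *m b) = 0.
  apply: (mulfI two_neq0); rewrite mulr0 mulr_natl mulr2n {2}sp_symp.
  by have := A0 (a + b); rewrite mulmxDr sympDl !sympDr !A0 add0r addr0.
have OA : Om *m sp_val A = 0.
  apply/matrixP => i j; have := S0 (delta_mx i 0) (delta_mx j 0).
  by rewrite /symp trmx_delta -mulmxA -rowE mulmxA -colE !mxE.
apply/eqP; apply: val_inj => /=.
by rewrite -[LHS](mulKmx symp_form_unit) OA mulmx0.
Qed.

(* With 0-based indices [sympv (2 i) = p_i + p_(i-1)] and [sympv (2 i + 1) = q_i]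
   for the standard symplectic basis [p], [q]. *)
Definition sympv (k : nat) : 'cV[F]_(n + n) :=
  \col_r (if odd k then r == (n + k./2)%N :> nat
           else (r == k./2 :> nat) || (r.+1 == k./2))%:R.

(** Vectors of equal parity lie in the same Lagrangian half. Otherwise at most one summand survives:
    [p_i] against [q_i] gives 1 for even [k], [q_i] against [p_i] gives -1 for odd [k]. *)
Lemma sympvE k l : (k < l)%N -> (l < n + n)%N ->
  symp (sympv k) (sympv l) = if l == k.+1 then (-1) ^+ k else 0.
Proof.
move=> kl ln; rewrite symp_sumE -signr_odd.
have kE := odd_double_half k; have lE := odd_double_half l.
case ok: (odd k) kE => /= kE; case ol: (odd l) lE => /= lE.
- rewrite big1 => [|r _].
    by case: ifP => // /eqP ?; subst l; rewrite /= ok in ol.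
  have rn := ltn_ord r.
  rewrite !mxE ok ol /= (_ : (r == n + k./2 :> nat)%N = false); last by lia.
  by rewrite (_ : (r == n + l./2 :> nat)%N = false) ?mul0r ?mulr0 ?subr0 //; lia.
- have jn : (k./2 < n)%N by lia.
  rewrite (bigD1 (Ordinal jn)) //= big1 => [|r rj]; last first.
    have rn := ltn_ord r; have {}rj : (r != k./2 :> nat) by [].
    rewrite !mxE ok ol /= eqn_add2l (negbTE rj).
    by rewrite (_ : (r == n + k./2 :> nat)%N = false) ?mul0r ?subr0 //; lia.
  rewrite !mxE ok ol /= eqxx mul1r.
  rewrite (_ : (k./2 == n + k./2)%N = false) ?mul0r ?sub0r ?addr0; last lia.
  rewrite (_ : (k./2 == l./2)%N = false) /=; last lia.
  rewrite (_ : (k./2.+1 == l./2)%N = (l == k.+1)); last lia.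
  by case: ifP; rewrite ?oppr0.
- have jn : (l./2 < n)%N by lia.
  rewrite (bigD1 (Ordinal jn)) //= big1 => [|r rj]; last first.
    have rn := ltn_ord r; have {}rj : (r != l./2 :> nat) by [].
    rewrite !mxE ok ol /= eqn_add2l (negbTE rj) mulr0.
    by rewrite (_ : (r == n + l./2 :> nat)%N = false) ?mulr0 ?subr0 //; lia.
  rewrite !mxE ok ol /= eqxx mulr1.
  rewrite (_ : (l./2 == n + l./2)%N = false) ?mulr0 ?subr0 ?addr0; last lia.
  rewrite (_ : (l./2.+1 == k./2)%N = false) ?orbF /=; last lia.
  rewrite (_ : (l./2 == k./2)%N = (l == k.+1)); last lia.
  by case: ifP.
- rewrite big1 => [|r _].
    by case: ifP => // /eqP ?; subst l; rewrite /= ok in ol.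
  have rn := ltn_ord r.
  rewrite !mxE ok ol /= (_ : (n + r == k./2 :> nat)%N = false); last by lia.
  rewrite (_ : ((n + r).+1 == k./2 :> nat)%N = false); last by lia.
  rewrite (_ : (n + r == l./2 :> nat)%N = false); last by lia.
  by rewrite (_ : ((n + r).+1 == l./2 :> nat)%N = false) ?mul0r ?mulr0 ?subr0 //; lia.
Qed.

Definition sympv_mx : 'M[F]_(n + n) := \matrix_(r, k) sympv k r 0.

(** For [v] in the left kernel, the odd columns [q_j] make its lower half vanish; the even columns
    [p_0], [p_1 + p_0], ... are then a unitriangular system for the upper half. *)
Lemma sympv_unit : sympv_mx \in unitmx.
Proof.
rewrite -row_free_unit; apply: inj_row_free => v vP.
have v0 k : (k < n + n)%N -> \sum_r v 0 r * sympv k r 0 = 0.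
  move=> kn; have := congr1 (fun M : 'rV_(n + n) => M 0 (Ordinal kn)) vP.
  by rewrite !mxE => H; rewrite -[RHS]H; apply: eq_bigr => r _; rewrite !mxE.
have vq (j : 'I_n) : v 0 (rshift n j) = 0.
  have jn := ltn_ord j.
  have := v0 j.*2.+1 ltac:(lia).
  rewrite (bigD1 (rshift n j)) //= big1 => [|r rj].
    by rewrite !mxE /= odd_double uphalf_double eqxx mulr1 addr0.
  rewrite !mxE /= odd_double uphalf_double /=.
  rewrite (_ : (r == n + j :> nat)%N = false) ?mulr0 //.
  by apply: negbTE; apply: contra rj => /eqP rj; apply/eqP/val_inj.
have vp (j : nat) (jn : (j < n)%N) : v 0 (lshift n (Ordinal jn)) = 0.
  elim: j jn => [|j IH] jn.
    have := v0 0 ltac:(lia).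
    rewrite (bigD1 (lshift n (Ordinal jn))) //= big1 => [|r rj].
      by rewrite !mxE /= mulr1 addr0.
    rewrite !mxE /= orbF (_ : (r == 0 :> nat)%N = false) ?mulr0 //.
    by apply: negbTE; apply: contra rj => /eqP rj; apply/eqP/val_inj.
  have := v0 j.+1.*2 ltac:(lia).
  rewrite (bigD1 (lshift n (Ordinal jn))) //= big1 => [|r rj].
    by rewrite !mxE /= odd_double doubleK eqxx mulr1 addr0.
  rewrite !mxE /= odd_double doubleK /= (_ : (r == j.+1 :> nat)%N = false) /=.
    case: eqP => [[rE]|_]; last by rewrite mulr0.
    have jn' : (j < n)%N by lia.
    have -> : r = lshift n (Ordinal jn') by apply: val_inj.
    by rewrite IH mul0r.
  by apply: negbTE; apply: contra rj => /eqP rj; apply/eqP/val_inj.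
apply/rowP => r; rewrite mxE.
by case: (splitP r) => j rE;
  [rewrite -(vp j (ltn_ord j))|rewrite -(vq j)]; congr (v _ _); apply: val_inj.
Qed.

End Symplectic.

(** * Coordinates and generators of the symplectic algebra *)

Section SympCoordinates.
Variables (F : fieldType) (n : nat).
Hypothesis two_neq0 : 2%:R != 0 :> F.
Local Notation Om := (symp_form F n).
Local Notation P := (sympv_mx F n).
Local Notation u := (@sympv F n).
Implicit Types (A B : sp F n).

(** The solution [C] of [A = P C P^T Om], as [Om] has inverse [- Om]: the coefficients of [A] in the
    halves of [sym_sq (u i) (u j)] over ordered pairs. *)
Definition sym_coord A : 'M[F]_(n + n) :=
  invmx P *m sp_val A *m (- Om) *m (invmx P)^T.

Lemma sym_coordP k A B : sym_coord (k *: A + B) = k *: sym_coord A + sym_coord B.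
Proof.
by rewrite /sym_coord /= mulmxDr !mulmxDl -scalemxAr -!scalemxAl.
Qed.

Lemma sym_coordT A : (sym_coord A)^T = sym_coord A.
Proof.
have OA : Om *m (sp_val A)^T = - (sp_val A *m Om).
  rewrite -[LHS]mulmx1 -[1%:M]opprK -symp_form_sqr mulmxN -mulmxA.
  rewrite [_ *m (Om *m Om)]mulmxA sp_trmx.
  by rewrite mulNmx mulmxN opprK !mulmxA symp_form_sqr mulNmx mul1mx mulNmx.
rewrite /sym_coord !trmx_mul trmxK linearN /= symp_formT opprK.
by rewrite mulmxA mulmxA -(mulmxA _ Om) OA !mulmxN !mulNmx !mulmxA.
Qed.

Lemma sum_sympv (M : 'M[F]_(n + n)) :
  \sum_(i < n + n) \sum_(j < n + n) M i j *: (u i *m (u j)^T) = P *m M *m P^T.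
Proof.
apply/matrixP => r s; rewrite summxE mxE.
under [RHS]eq_bigr => j _ do rewrite !mxE mulr_suml.
rewrite exchange_big /=; apply: eq_bigr => j _; rewrite summxE.
apply: eq_bigr => i _; rewrite !mxE big_ord1 !mxE.
by rewrite mulrCA !mulrA [_ * M _ _]mulrC.
Qed.

Lemma sympv_coord (i : 'I_(n + n)) : invmx P *m u i = delta_mx i 0.
Proof.
have -> : u i = P *m delta_mx i 0.
  by rewrite -colE; apply/colP => r; rewrite !mxE.
by rewrite mulmxA mulVmx ?mul1mx ?sympv_unit.
Qed.

Lemma sym_coord_sq (i j : 'I_(n + n)) :
  sym_coord (sym_sq (u i) (u j)) = delta_mx i j + delta_mx j i.
Proof.
rewrite /sym_coord /= -mulmxDl -!mulmxA [Om *m _]mulmxA mulmxN symp_form_sqr.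
rewrite opprK mul1mx.
rewrite mulmxDl mulmxDr -!mulmxA -!trmx_mul !sympv_coord !mulmxA !sympv_coord.
by rewrite !trmx_delta !mul_delta_mx.
Qed.

Lemma sym_coordK A :
  \sum_(i < n + n) \sum_(j < n + n)
    sym_coord A i j *: (2%:R^-1 *: sym_sq (u i) (u j)) = A.
Proof.
pose C := sym_coord A; pose X i j : 'M_(n + n) := u i *m (u j)^T.
have -> : \sum_(i < n + n) \sum_(j < n + n)
      C i j *: (2%:R^-1 *: sym_sq (u i) (u j)) =
    2%:R^-1 *: \sum_(i < n + n) \sum_(j < n + n) C i j *: sym_sq (u i) (u j).
  rewrite scaler_sumr; apply: eq_bigr => i _; rewrite scaler_sumr.
  by apply: eq_bigr => j _; rewrite !scalerA mulrC.
have CX : \sum_(i < n + n) \sum_(j < n + n) C i j *: X i j = P *m C *m P^T.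
  exact: sum_sympv.
have CXT : \sum_(i < n + n) \sum_(j < n + n) C i j *: X j i = P *m C *m P^T.
  rewrite -CX [RHS]exchange_big; apply: eq_bigr => i _; apply: eq_bigr => j _.
  by rewrite /C -[in LHS](sym_coordT A) mxE.
apply: val_inj; transitivity (2%:R^-1 *: ((P *m C *m P^T + P *m C *m P^T) *m Om)).
  rewrite -{1}CX -CXT -big_split mulmx_suml linearZ /=; congr (_ *: _).
  rewrite [LHS](raddf_sum val); apply: eq_bigr => i _ /=.
  rewrite -big_split mulmx_suml /= [LHS](raddf_sum val); apply: eq_bigr => j _ /=.
  by rewrite -scalerDr -scalemxAl mulmxDl.
rewrite -mulr2n -scaler_nat -scalemxAl scalerA mulVf // scale1r /C /sym_coord.
rewrite !mulmxA mulmxV ?sympv_unit // mul1mx -(mulmxA _ (invmx P)^T).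
rewrite -trmx_mul mulmxV ?sympv_unit //.
by rewrite trmx1 mulmx1 -mulmxA mulNmx symp_form_sqr opprK mulmx1.
Qed.

(** The inverse [h] combines the [q i j] with coefficients [sym_coord A]. One composition is
    [sym_coordK]; the other is checked on the spanning [q i j]. *)
Lemma sp_bijective (L : lieType F) (f : {linear L -> sp F n})
    (q : nat -> nat -> L) :
  (forall i j, q i j = q j i) ->
  (forall i j, (i < n + n)%N -> (j < n + n)%N ->
    f (q i j) = 2%:R^-1 *: sym_sq (u i) (u j)) ->
  (forall T : set L, is_subspace T ->
    (forall i j, (i < n + n)%N -> (j < n + n)%N -> T (q i j)) -> forall x, T x) ->
  bijective f.
Proof.
move=> qC fq q_span.
pose h A := \sum_(i < n + n) \sum_(j < n + n) sym_coord A i j *: q i j.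
have hP k A B : h (k *: A + B) = k *: h A + h B.
  rewrite /h scaler_sumr -big_split; apply: eq_bigr => i _ /=.
  rewrite scaler_sumr -big_split; apply: eq_bigr => j _ /=.
  by rewrite sym_coordP !mxE scalerA scalerDl.
have h0 : h 0 = 0.
  have := hP (-1) 0 0; rewrite scaleN1r oppr0 addr0 => {1}->.
  by rewrite scaleN1r addNr.
exists h => [x|A]; last first.
  rewrite -[RHS]sym_coordK linear_sum; apply: eq_bigr => i _.
  by rewrite linear_sum; apply: eq_bigr => j _; rewrite linearZ /= fq.
move: x; apply: (q_span [set x | h (f x) = x]) => [|i j im jm] /=.
  split=> [|k x y /= hx hy]; last by rewrite linearP hP hx hy.
  by rewrite /= linear0 h0.
have hq (i' j' : 'I_(n + n)) : h (f (q i' j')) = q i' j'.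
  rewrite fq // -[_ *: _]addr0 hP h0 addr0.
  have dE (a b : 'I_(n + n)) : \sum_(i < n + n) \sum_(j < n + n)
      (delta_mx a b : 'M[F]_(n + n)) i j *: q i j = q a b.
    rewrite (bigD1 a) //= [X in _ + X]big1 ?addr0 => [|k ka]; last first.
      by rewrite big1 // => l _; rewrite mxE (negbTE ka) scale0r.
    rewrite (bigD1 b) //= big1 ?addr0 => [|l lb].
      by rewrite mxE !eqxx scale1r.
    by rewrite mxE (negbTE lb) andbF scale0r.
  (* The two matrix units give [q i' j' + q j' i']; symmetry of [q] and the factor 1/2 return
     [q i' j']. *)
  rewrite /h sym_coord_sq.
  under eq_bigr => k _ do under eq_bigr => l _ do rewrite mxE scalerDl.
  under eq_bigr => k _ do rewrite big_split /=.
  rewrite big_split /= !dE (qC j') -mulr2n -scaler_nat scalerA.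
  by rewrite mulVf ?scale1r.
exact: (hq (Ordinal im) (Ordinal jm)).
Qed.

(** The sign makes [sp_gen k] send both neighbours [u k.-1] and [u k.+1] to [u k] with coefficient
    1. *)
Definition sp_gen (k : nat) : sp F n := ((-1) ^+ k / 2%:R) *: sym_sq (u k) (u k).

Let sqr_sign1 k : (-1) ^+ k * (-1) ^+ k = 1 :> F.
Proof. by rewrite -exprMn mulrNN mulr1 expr1n. Qed.

Lemma sp_gen_mul k l : (k < n + n)%N -> (l < n + n)%N ->
  sp_val (sp_gen k) *m u l = if (l == k.+1) || (k == l.+1) then u k else 0.
Proof.
move=> km lm.
have -> : sp_val (sp_gen k) *m u l = ((-1) ^+ k * symp (u k) (u l)) *: u k.
  rewrite /= -scalemxAl sym_sq_mul scalerA.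
  by congr (_ *: _); rewrite mulrA -[_ / _ * _]mulrA mulVf ?mulr1.
have [kl|lk|<-] := ltngtP k l.
- rewrite sympvE // (_ : (k == l.+1)%N = false) ?orbF; last lia.
  case: ifP => _; last by rewrite mulr0 scale0r.
  by rewrite sqr_sign1 scale1r.
- rewrite sympC sympvE // (_ : (l == k.+1)%N = false) /=; last lia.
  case: eqP => [->|_]; last by rewrite oppr0 mulr0 scale0r.
  by rewrite exprS mulN1r mulrNN sqr_sign1 scale1r.
by rewrite sympxx // mulr0 scale0r (_ : (k == k.+1)%N = false) //; lia.
Qed.

Lemma lie_sp_gen k a b : (k < n + n)%N -> (a < n + n)%N -> (b < n + n)%N ->
  lie (sp_gen k) (sym_sq (u a) (u b)) =
    (if (a == k.+1) || (k == a.+1) then sym_sq (u k) (u b) else 0) +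
    (if (b == k.+1) || (k == b.+1) then sym_sq (u a) (u k) else 0).
Proof.
move=> km am bm; rewrite lie_sym_sq !sp_gen_mul //.
by congr (_ + _); case: ifP; rewrite ?sym_sq0l ?sym_sq0r.
Qed.

Lemma sp_genC i j : (i.+1 < j)%N -> (j < n + n)%N -> lie (sp_gen i) (sp_gen j) = 0.
Proof.
move=> ij jm; rewrite [sp_gen j]/sp_gen lieZr lie_sp_gen //; last lia.
rewrite (_ : (j == i.+1) || (i == j.+1) = false) ?addr0 ?scaler0 //; lia.
Qed.

(** The two brackets turn both factors [u l] into [u k], leaving [(-1) ^+ l] times the square of
    [u k]; neighbours have opposite signs. *)
Lemma sp_gen_adj k l : (k < n + n)%N -> (l < n + n)%N ->
  (l == k.+1) || (k == l.+1) ->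
  lie (sp_gen k) (lie (sp_gen k) (sp_gen l)) = - 2%:R *: sp_gen k.
Proof.
move=> km lm kl; rewrite [sp_gen l]/sp_gen lieZr lie_sp_gen // kl.
rewrite [sym_sq (u l) _]sym_sqC.
rewrite -mulr2n -scaler_nat scalerA mulfVK // lieZr lie_sp_gen // kl.
rewrite (_ : (k == k.+1) || (k == k.+1) = false) ?add0r; last lia.
rewrite scalerA mulrCA mulNr mulfV // mulrN1; congr (_ *: _).
by case/orP: kl => /eqP ->; rewrite exprS mulN1r ?opprK.
Qed.

(** Each further generator moves the second factor one step along. Offset 0 is excluded because of
    the 1/2 in [sp_gen], which the first bracket cancels by hitting two equal factors. *)
Lemma sp_gen_root (L : lieType F) (f : {linear L -> sp F n}) (e : nat -> L) i d :
  (forall x y, f (lie x y) = lie (f x) (f y)) ->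
  (forall k, (k < n + n)%N -> f (e k) = sp_gen k) -> (i + d.+1 < n + n)%N ->
  f (chain_root e i d.+1) = (-1) ^+ i *: sym_sq (u i) (u (i + d.+1)%N).
Proof.
move=> fM fe; elim: d => [|d IH] im; rewrite [chain_root _ _ _]/= fM fe //.
  rewrite fe ?[sp_gen i]/sp_gen; last lia.
  rewrite lieZr lie_sp_gen //; try lia.
  rewrite addn1 eqxx orbT [sym_sq (u i.+1) _]sym_sqC -mulr2n -scaler_nat scalerA.
  by rewrite mulfVK.
rewrite IH ?lieZr ?lie_sp_gen //; try lia.
rewrite (_ : (i == _) || _ = false) ?add0r; last lia.
by rewrite (_ : (_ == _) || _ = true) //; lia.
Qed.

End SympCoordinates.

(** * Presentations *)

Section UniversalProperties.
Variable (F : fieldType).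

Lemma linearP_ex (L1 L2 : lmodType F) (f : L1 -> L2) :
  linear f -> exists g : {linear L1 -> L2}, g =1 f.
Proof.
move=> lf; pose b := GRing.isLinear.Build F L1 L2 *:%R f lf.
by exists (HB.pack f b : {linear L1 -> L2}).
Qed.

Lemma free_lie_ind (X : Type) (T : set (free_lie F X)) : is_subspace T ->
  (forall x y, T x -> T y -> T (lie x y)) -> (forall i, T (fl_gen F i)) ->
  forall x, T x.
Proof.
move=> sT lT gT x; rewrite -(fl_piK x); move: (repr x).
elim=> [i||t Tt|t Tt u Tu|a t Tt|t Tt u Tu].
- exact: gT.
- by case: sT.
- by rewrite -fl_piN; apply: (subspaceN sT).
- by rewrite -fl_piD; apply: (subspaceD sT).
- by rewrite -fl_piZ; apply: (subspaceZ _ sT).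
- by rewrite -fl_pi_lie; apply: lT.
Qed.

Lemma free_lie_lift (X : Type) (L : lieType F) (h : X -> L) :
  exists f : {linear free_lie F X -> L},
    (forall x y, f (lie x y) = lie (f x) (f y)) /\ forall i, f (fl_gen F i) = h i.
Proof.
pose ev := fix ev (t : lie_term F X) : L := match t with
  | LGen i => h i | LZero => 0 | LOpp t => - ev t | LAdd t u => ev t + ev u
  | LScale a t => a *: ev t | LBr t u => lie (ev t) (ev u) end.
have evP t u : lie_cong t u -> ev t = ev u.
  elim=> //= {t u} *;
    rewrite ?(addrA, addNr, add0r, scalerA, scale1r) //; try congruence.
  - exact: addrC.
  - exact: scalerDr.
  - exact: scalerDl.
  - exact: liePl.
  - exact: liePr.
  - exact: liexx.
  - exact: lie_jacobi.
have evE t : ev (repr (fl_pi t)) = ev t by apply/evP/fl_pi_eq; rewrite fl_piK.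
have /linearP_ex[f fE] : linear (fun x : free_lie F X => ev (repr x)).
  move=> a x y; rewrite -[in LHS](fl_piK x) -[in LHS](fl_piK y).
  rewrite /GRing.scale /GRing.add /= fl_piZ fl_piD evE //.
exists f; split=> [x y|i]; rewrite !fE; last exact: evE.
by rewrite -[in LHS](fl_piK x) -[in LHS](fl_piK y) [lie _ _]fl_pi_lie evE.
Qed.

Lemma lie_piP (L : lieType F) (I : lieIdeal L) a x y :
  lie_pi I (a *: x + y) = a *: lie_pi I x + lie_pi I y.
Proof. by rewrite lie_piD -lie_piZ. Qed.

Lemma lie_piM (L : lieType F) (I : lieIdeal L) x y :
  lie_pi I (lie x y) = lie (lie_pi I x) (lie_pi I y).
Proof. by rewrite [RHS]lie_pi_lie. Qed.

Lemma lie_pi0 (L : lieType F) (I : lieIdeal L) : lie_pi I 0 = 0.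
Proof.
have := lie_piP I (-1) 0 0; rewrite scaleN1r oppr0 addr0 => ->.
by rewrite scaleN1r addNr.
Qed.

Lemma lie_pi_eq0 (L : lieType F) (I : lieIdeal L) x :
  lie_pi I x = 0 <-> ideal_set I x.
Proof. by have := lie_pi_eq I x 0; rewrite lie_pi0 subr0. Qed.

Lemma lie_quot_ind (L : lieType F) (I : lieIdeal L) (S : set L)
    (T : set (lie_quot I)) :
  (forall T' : set L, is_subspace T' ->
    (forall x y, T' x -> T' y -> T' (lie x y)) -> S `<=` T' -> forall x, T' x) ->
  is_subspace T -> (forall x y, T x -> T y -> T (lie x y)) ->
  (forall x, S x -> T (lie_pi I x)) -> forall x, T x.
Proof.
move=> S_gen sT lT ST x; rewrite -(lie_piK x); move: (repr x).
apply: (S_gen [set y | T (lie_pi I y)]) => //= [|y z Ty Tz].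
  split=> /= [|a y z Ty Tz]; first by rewrite lie_pi0; case: sT.
  by rewrite lie_piP; apply: (proj2 sT).
by rewrite lie_piM; apply: lT.
Qed.

Lemma kernel_ideal (L L' : lieType F) (f : {linear L -> L'}) :
  (forall x y, f (lie x y) = lie (f x) (f y)) -> is_ideal [set x | f x = 0].
Proof.
move=> fM; split=> [|x y /= fy]; last by rewrite fM fy lie0r.
split=> [|a x y /= fx fy] /=; first exact: linear0.
by rewrite linearP fx fy scaler0 addr0.
Qed.

Lemma lie_quot_lift (L L' : lieType F) (S : set L) (f : {linear L -> L'}) :
  (forall x y, f (lie x y) = lie (f x) (f y)) -> (forall x, S x -> f x = 0) ->
  exists g : {linear lie_quot (ideal_gen S) -> L'},
    (forall x y, g (lie x y) = lie (g x) (g y)) /\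
    forall x, g (lie_pi (ideal_gen S) x) = f x.
Proof.
move=> fM fS; set I := ideal_gen S.
have fI x : ideal_set I x -> f x = 0.
  by move=> Ix; apply: (Ix [set z | f z = 0]); split; [apply: kernel_ideal|].
have fE x : f (repr (lie_pi I x)) = f x.
  by apply/subr0_eq; rewrite -linearB; apply/fI/lie_pi_eq; apply: lie_piK.
have /linearP_ex[g gE] : linear (fun x : lie_quot I => f (repr x)).
  move=> a x y; rewrite -[in LHS](lie_piK x) -[in LHS](lie_piK y) -lie_piP fE.
  exact: linearP.
exists g; split=> [x y|x]; by rewrite !gE fE.
Qed.

End UniversalProperties.

(** * Solvable ideals under a map onto the symplectic algebra *)

Section SolvableImage.
Variables (F : fieldType) (n : nat) (L : lieType F) (f : {linear L -> sp F n}).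
Hypothesis two_neq0 : 2%:R != 0 :> F.
Hypothesis fM : forall x y, f (lie x y) = lie (f x) (f y).
Hypothesis f_surj : forall A, exists x, f x = A.

(* Double brackets with the square of a vector [v] return multiples of that
   square, so once the derived series of an ideal meets the line of a square it
   never leaves it. *)
Lemma sp_solvable_ideal (K : set L) : is_ideal K -> solvable K ->
  forall x, K x -> f x = 0.
Proof.
move=> idK [k Kk] x Kx; apply/eqP; apply: contrapT => /negP fx0.
have four_neq0 : 4%:R != 0 :> F by rewrite -[4%N]/(2 * 2)%N natrM mulf_neq0.
have [v vv] := sp_form_neq0 two_neq0 fx0; set w := sp_val (f x) *m v in vv.
have [xi xiE] := f_surj (sym_sq v v); have [eta etaE] := f_surj (sym_sq w w).
have [y [Ky [c c0 fy]]] : exists y, derived K k y /\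
    exists2 c, c != 0 & f y = c *: sym_sq v v.
  elim: k {Kk} => [|k [y [Ky [c c0 fy]]]].
    exists (lie xi (lie xi x)); split; first by do 2!apply: (proj2 idK).
    exists (- (4%:R * symp v w)); last by rewrite !fM xiE sym_sq_lie2.
    by rewrite oppr_eq0 mulf_neq0.
  have [_ idD] := derived_ideal k idK.
  (* Both [y] and [[y, eta]] lie in the current derived term. The image of their bracket is a
     nonzero multiple of the square of [v], as the square of [w] maps [v] to [2 symp w v] times
     [w]. *)
  exists (lie y (lie y eta)); split.
    apply: sub_lie_span; exists y => //; exists (lie y eta) => //.
    rewrite lieC; apply: subspaceN; first exact: (proj1 (derived_ideal k idK)).
    exact: idD.
  rewrite !fM fy etaE !lieZl lieZr sym_sq_lie2 // sym_sq_mul !scalerA.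
  eexists; last by [].
  rewrite !mulf_neq0 ?oppr_eq0 ?mulf_neq0 //.
  rewrite /symp -scalemxAr mxE; apply: mulf_neq0 => //; apply: mulf_neq0 => //.
  by rewrite -/(symp w v) sympC oppr_eq0.
have y0 : y = 0 by move: Ky; rewrite Kk.
move: fy; rewrite y0 linear0 => /esym/eqP.
rewrite scaler_eq0 (negbTE c0) /= => /eqP X0.
(* A vanishing square of [v] would kill [w], so [2 symp v w] times [v] would be 0, forcing
   [v = 0]. *)
have := sym_sq_mul v w; rewrite X0 mul0mx => /esym/eqP.
rewrite scaler_eq0 !mulf_eq0 (negbTE two_neq0) (negbTE vv) /= => /eqP v0.
by move: vv; rewrite v0 /symp trmx0 !mul0mx mxE eqxx.
Qed.

End SolvableImage.

(** [D_edge] carried over to natural numbers, where adjacency is plain arithmetic. *)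
Definition fork_edge (i j : nat) : bool :=
  [|| (i == 0) && (j == 2), (i == 1) && (j == 2) | (2 <= i) && (j == i.+1)]%N.

(** * Generators and relations of type D *)

Section ElectricalD.
Variables (F : fieldType) (m : nat).
Hypothesis m_gt1 : (1 < m)%N.
Local Notation e k := (@eD_gen F m (inord k)).

Lemma eD_adj i j : (i <= m)%N -> (j <= m)%N ->
  fork_edge i j ||
  fork_edge j i ->
  lie (e i) (lie (e i) (e j)) = - 2%:R *: e i.
Proof.
move=> im jm ij; rewrite -(lie_piM _ _ (fl_gen F (inord j))) -lie_piM [RHS]lie_piZ.
apply/lie_pi_eq => I [_]; apply; left; exists (inord i), (inord j); split=> //.
by rewrite /D_adj /D_edge !inordK.
Qed.

Lemma eD_nonadj i j : (i < j)%N -> (j <= m)%N ->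
  ~~ fork_edge i j ->
  lie (e i) (e j) = 0.
Proof.
move=> ij jm nij; rewrite -lie_piM; apply/lie_pi_eq0 => I [_]; apply; right.
exists (inord i), (inord j); split=> //.
  by apply/eqP => /(congr1 val); rewrite /= !inordK; lia.
by move: nij; rewrite /fork_edge /D_adj /D_edge !inordK; lia.
Qed.

Lemma eD_ind (T : set (eD F m)) : is_subspace T ->
  (forall x y, T x -> T y -> T (lie x y)) -> (forall k, (k <= m)%N -> T (e k)) ->
  forall x, T x.
Proof.
move=> sT lT eT.
apply: (lie_quot_ind (S := [set x | exists i, x = fl_gen F i])) => //.
  by move=> T' sT' lT' gT'; apply: free_lie_ind => // i; apply: gT'; exists i.
by move=> _ [i ->]; rewrite -(inord_val i); apply: eT; rewrite -ltnS.
Qed.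

Lemma eD_lift (L : lieType F) (h : nat -> L) :
  (forall i j, (i <= m)%N -> (j <= m)%N ->
  fork_edge i j ||
  fork_edge j i ->
   lie (h i) (lie (h i) (h j)) = - 2%:R *: h i) ->
  (forall i j, (i < j)%N -> (j <= m)%N ->
  ~~ fork_edge i j ->
  lie (h i) (h j) = 0) ->
  exists f : {linear eD F m -> L}, (forall x y, f (lie x y) = lie (f x) (f y)) /\
    forall k, (k <= m)%N -> f (e k) = h k.
Proof.
move=> hA hC.
have [f [fM fg]] := free_lie_lift (fun i : 'I_m.+1 => h i).
have [|g [gM gE]] := @lie_quot_lift F _ L (@eD_relators F m) f fM.
  move=> _ [[a [b [ab ->]]]|[a [b [ab nab ->]]]].
    have fB x y : f (x - y) = f x - f y by exact: linearB.
    have fZ k x : f (k *: x) = k *: f x by exact: linearZ.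
    rewrite fB fM fM fZ !fg.
    apply/eqP; rewrite subr_eq0; apply/eqP.
    by apply: hA ab; rewrite -ltnS.
  rewrite fM !fg; move: nab; rewrite /D_adj negb_or => /andP[nab nba].
  have := ab; rewrite -val_eqE neq_ltn => /orP[] abl.
    by apply: hC => //; rewrite -ltnS.
  by apply/lie_sym0/hC => //; rewrite -ltnS.
exists g; split=> // k km; rewrite [g _]gE fg inordK //.
Qed.

End ElectricalD.

(** * The radical of the electrical Lie algebra of type D *)

Section Main.
Variables (F : fieldType) (n : nat).
Hypothesis two_neq0 : 2%:R != 0 :> F.
Hypothesis n_gt0 : (0 < n)%N.
Local Notation e k := (@eD_gen F (2 * n) (inord k)).
Local Notation J := (ideal_gen [set e 1 - e 0]).
Local Notation c k := (lie_pi J (e k.+1)).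

Let m_gt1 : (1 < 2 * n)%N. Proof. lia. Qed.

Lemma eD_ideal_solvable : solvable J.
Proof.
have edge i j := @eD_adj F (2 * n) i j; have far i j := @eD_nonadj F (2 * n) i j.
apply: (@fork_ideal_solvable F (eD F (2 * n)) (2 * n) (fun k => e k)) => //.
- by apply: far; rewrite /fork_edge; lia.
- by move=> i j ij jm nij; apply: far; rewrite /fork_edge; lia.
- by apply: edge; rewrite /fork_edge; lia.
- by apply: edge; rewrite /fork_edge; lia.
- by move=> i i0 im; apply: edge; rewrite /fork_edge; lia.
- by move=> i i0 im; apply: edge; rewrite /fork_edge; lia.
- exact: eD_ind.
Qed.

(** The truncated predecessor sends both fork nodes 0 and 1 to [sp_gen 0], folding the diagram onto
    a linear one. *)
Lemma eD_sp : exists f : {linear eD F (2 * n) -> sp F n},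
  (forall x y, f (lie x y) = lie (f x) (f y)) /\
  forall k, (k <= 2 * n)%N -> f (e k) = sp_gen F n k.-1.
Proof.
apply: eD_lift => i j ij jm ijE.
  by apply: sp_gen_adj => //; move: ijE; rewrite /fork_edge; lia.
have [->|i0] := eqVneq i 0%N; last first.
  by apply: sp_genC; move: ijE; rewrite /fork_edge; lia.
have [->|j1] := eqVneq j 1%N; first exact: liexx.
by apply: sp_genC => //; move: ijE; rewrite /fork_edge; lia.
Qed.

Lemma eD_quot_sp (f : {linear lie_quot J -> sp F n}) :
  (forall x y, f (lie x y) = lie (f x) (f y)) ->
  (forall k, (k < n + n)%N -> f (c k) = sp_gen F n k) -> bijective f.
Proof.
move=> fM fc; pose c' k : lie_quot J := c k.
have sgn2 k : (-1) ^+ k * (-1) ^+ k = 1 :> F by rewrite -exprMn mulrNN mulr1 expr1n.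
(* Chains are rescaled so that [f (q i j)] is half of [sym_sq (u i) (u j)]; [minn] and [maxn] make
   [q] symmetric. *)
pose q i j := if i == j then (-1) ^+ i *: c' i
  else ((-1) ^+ minn i j / 2%:R) *: chain_root c' (minn i j) (maxn i j - minn i j).
have qE i d : q i (i + d.+1)%N = ((-1) ^+ i / 2%:R) *: chain_root c' i d.+1.
  rewrite /q (_ : (i == _) = false); last lia.
  rewrite (_ : minn i _ = i); last lia.
  by congr (_ *: chain_root _ _ _); lia.
have qC i j : q i j = q j i by rewrite /q eq_sym minnC maxnC; case: eqP => [->|].
apply: (sp_bijective two_neq0 qC) => [i j im jm|T sT qT].
  wlog ij : i j im jm / (i <= j)%N.
    by move=> H; have [/H|/ltnW/H] := leqP i j; [apply|rewrite qC sym_sqC; apply].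
  move: ij; rewrite leq_eqVlt => /orP[/eqP <-|ij].
    by rewrite /q eqxx linearZ /= fc // /sp_gen scalerA mulrA sgn2 mul1r.
  have [d jE] : exists d, j = (i + d.+1)%N by exists (j - i).-1; lia.
  rewrite jE qE linearZ /= (sp_gen_root two_neq0 fM fc) -?jE // scalerA mulrAC.
  by rewrite sgn2 mul1r.
have adj i j : (i <= 2 * n)%N -> (j <= 2 * n)%N -> fork_edge i j || fork_edge j i ->
    lie (lie_pi J (e i)) (lie (lie_pi J (e i)) (lie_pi J (e j))) =
    - 2%:R *: lie_pi J (e i).
  move=> im jm ij; rewrite -(lie_piM _ _ (e j)) -lie_piM eD_adj //.
  by rewrite -[_ *: e i]addr0 lie_piP lie_pi0 addr0.
apply: (chain_root_span (m := n + n) (e := c')) => //.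
- move=> i j ij jm; rewrite -lie_piM eD_nonadj ?lie_pi0 /fork_edge //; lia.
- by move=> i im; apply: adj; rewrite ?/fork_edge; lia.
- by move=> i im; apply: adj; rewrite ?/fork_edge; lia.
- move=> T' sT' lT' eT'.
  apply: (lie_quot_ind (S := [set x | exists2 k, (k <= 2 * n)%N & x = e k])) => //.
    by move=> T1 sT1 lT1 ST1; apply: eD_ind => // k km; apply: ST1; exists k.
  move=> _ [[|k] km ->]; last by apply: eT'; lia.
  (* The classes of [e 0] and [e 1] agree, so node 0 adds no new generator. *)
  suff -> : lie_pi J (e 0) = c' 0 by apply: eT'; lia.
  by apply/esym/lie_pi_eq => I [_]; apply.
- move=> i [|d] im.
    have -> : chain_root c' i 0 = (-1) ^+ i *: q i i.
      by rewrite /q eqxx scalerA sgn2 scale1r.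
    by apply: (subspaceZ _ sT); apply: qT; lia.
  have -> : chain_root c' i d.+1 = ((-1) ^+ i * 2%:R) *: q i (i + d.+1)%N.
    by rewrite qE scalerA mulrACA sgn2 mulfV // mulr1 scale1r.
  by apply: (subspaceZ _ sT); apply: qT; lia.
Qed.

(** A solvable ideal is killed by [f], which is [g] after the projection; as [g] is injective, the
    ideal already projects to 0 and so lies in [J]. *)
Lemma eD_radical_quotient : is_radical J /\ lie_iso (lie_quot J) (sp F n).
Proof.
have [f [fM fe]] := eD_sp.
have [|g [gM gE]] := @lie_quot_lift F _ _ [set e 1 - e 0] f fM.
  by move=> _ ->; rewrite linearB !fe ?subrr //; lia.
have gb : bijective g by apply: eD_quot_sp => // k km; rewrite gE fe //; lia.
have [h gK hK] := gb; split; last by exists g.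
split; [exact: idealP|exact: eD_ideal_solvable|move=> K idK solK x Kx].
apply/lie_pi_eq0; apply: (can_inj gK); rewrite linear0 gE.
apply: sp_solvable_ideal Kx => // A; exists (repr (h A)).
by rewrite -gE lie_piK hK.
Qed.

End Main.

Theorem theorem2p21 (R : realType) (n : nat) (hn : (1 <= n)%N) :
  let e := @eD_gen R[i] (2 * n) in
  let J := ideal_gen [set e (inord 1) - e (inord 0)] in
  is_radical J /\ lie_iso (lie_quot J) (sp R[i] n).
Proof. by apply: eD_radical_quotient => //; rewrite Num.Theory.pnatr_eq0. Qed.
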